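(* Let $R$ be a Noetherian ring, let $I,J$ be ideals of $R$, let $T$ be a finitely generated $R$-module and let $U,V,W$ be submodules of $T$ with $W\subseteq V$. For $n\ge 0$ put $T_n=(U+I^nV)/I^nW$. Then the sequence $\{\operatorname{depth}_J T_n\}_{n\ge 0}$ is eventually constant.
   Context: For a finitely generated module $N$, $\operatorname{depth}_J N$ is the length of a maximal $N$-regular sequence in $J$, with the convention $\operatorname{depth}_J N=\infty$ if $JN=N$. *)

(* Defs.v *)
From mathcomp Require Import all_boot all_algebra.
Set Implicit Arguments. Unset Strict Implicit. Unset Printing Implicit Defensive.
Import GRing.Theory.
Local Open Scope ring_scope.

Section CommAlg.
Variable R : comPzRingType.

Definition is_ideal (I : R -> Prop) : Prop :=
  [/\ I 0, (forall x y, I x -> I y -> I (x + y)) & (forall a x, I x -> I (a * x))].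

Definition noetherian_ring : Prop :=
  forall I : R -> Prop, is_ideal I ->
    exists s : seq R, forall x, I x <->
      exists c : 'I_(size s) -> R, x = \sum_(i < size s) c i * s`_i.

Variable T : lmodType R.

Definition is_submodule (U : T -> Prop) : Prop :=
  [/\ U 0, (forall x y, U x -> U y -> U (x + y)) & (forall a x, U x -> U (a *: x))].

Definition finitely_generated_module : Prop :=
  exists s : seq T, forall x : T,
    exists c : 'I_(size s) -> R, x = \sum_(i < size s) c i *: s`_i.

Definition addS (U V : T -> Prop) : T -> Prop :=
  fun x => exists u v, [/\ U u, V v & x = u + v].

Definition prodIM (I : R -> Prop) (V : T -> Prop) : T -> Prop :=
  fun x => exists n (a : 'I_n -> R) (v : 'I_n -> T),
    [/\ forall i, I (a i), forall i, V (v i) & x = \sum_(i < n) a i *: v i].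

Definition powIM (I : R -> Prop) (n : nat) (V : T -> Prop) : T -> Prop :=
  iter n (prodIM I) V.

Definition seqIM (xs : seq R) (N : T -> Prop) : T -> Prop :=
  fun x => exists m : 'I_(size xs) -> T,
    (forall i, N (m i)) /\ x = \sum_(i < size xs) xs`_i *: m i.

(* For K a submodule of N, M := N/K.  An element m of N represents 0 in
   M/(x_1..x_i)M  iff  m lies in K + (x_1..x_i)N. *)
Definition regular_seq (J : R -> Prop) (N K : T -> Prop) (xs : seq R) : Prop :=
  [/\ forall i, (i < size xs)%N -> J xs`_i,
      (forall i, (i < size xs)%N -> forall m, N m ->
          addS K (seqIM (take i xs) N) (xs`_i *: m) ->
          addS K (seqIM (take i xs) N) m)
    & ~ (forall m, N m -> addS K (seqIM xs N) m)].

Definition maximal_regular_seq (J : R -> Prop) (N K : T -> Prop) (xs : seq R) :=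
  regular_seq J N K xs /\ ~ (exists y, regular_seq J N K (rcons xs y)).

(* depth_J (N/K) = d, where None stands for infinity (convention when JM = M) *)
Definition depth_is (J : R -> Prop) (N K : T -> Prop) (d : option nat) : Prop :=
  match d with
  | None => forall m, N m -> addS K (prodIM J N) m
  | Some k =>
      ~ (forall m, N m -> addS K (prodIM J N) m) /\
      (exists xs, maximal_regular_seq J N K xs /\ size xs = k) /\
      (forall xs, maximal_regular_seq J N K xs -> size xs = k)
  end.

End CommAlg.

(* Main.v *)
Require Import Defs.
From mathcomp Require Import all_boot all_algebra.
From Stdlib Require Import Classical ClassicalEpsilon.
From Stdlib Require Import FunctionalExtensionality PropExtensionality.
Set Implicit Arguments.
Unset Strict Implicit.
Unset Printing Implicit Defensive.
Import GRing.Theory.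
Local Open Scope ring_scope.

(* Call a sequence of submodules good if it is eventually [E + I^(n-c) F].  By
   Artin-Rees, good sequences are closed under intersection and under colon by
   an element, so the socle [(0 : J)] of [N_n / K_n] is a quotient of good
   sequences, and an inclusion between good sequences eventually always holds or
   eventually always fails.  Hence [J] either eventually kills a nonzero element
   of [N_n / K_n], or eventually none.  In the second case, since only finitely
   many primes are associated to the modules [N_n / K_n] for large [n] (filter by
   powers of [I], as Brodmann does for [R / I^n]), prime avoidance provides one
   [z] in [J] regular on all of them; replace [K_n] by [K_n + z N_n], which is
   again good, and repeat.  This stops by the ascending chain condition and gives
   a regular sequence that is maximal for all large [n]; its length is the depth
   because all maximal regular sequences in [J] have the same length. *)

(** * Predicates as subsets, ascending chains and maximal elements *)

Definition subS (A : Type) (P Q : A -> Prop) : Prop := forall x, P x -> Q x.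
Definition interS (A : Type) (P Q : A -> Prop) : A -> Prop :=
  fun x => P x /\ Q x.

Lemma predext (A : Type) (P Q : A -> Prop) : subS P Q -> subS Q P -> P = Q.
Proof.
move=> PQ QP; apply: functional_extensionality => x.
by apply: propositional_extensionality; split; [apply: PQ|apply: QP].
Qed.

Lemma chain_le (A : Type) (X : nat -> A -> Prop) :
  (forall s, subS (X s) (X s.+1)) ->
  forall s t, (s <= t)%N -> subS (X s) (X t).
Proof.
move=> XS s t /subnK <-; elim: (t - s)%N => [|k IH] x Xx //.
by rewrite addSn; apply: XS; apply: IH.
Qed.

(** Without a maximal element, dependent choice would produce a strictly ascending sequence in [P],
    contrary to the hypothesis on sequences. *)
Lemma exists_maximal (A : Type) (le : A -> A -> Prop) (P : A -> Prop) :
  (forall f : nat -> A, (forall n, P (f n) /\ le (f n) (f n.+1)) ->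
     exists n, le (f n.+1) (f n)) ->
  (exists a, P a) ->
  exists a, P a /\ forall b, P b -> le a b -> le b a.
Proof.
move=> acc [a0 Pa0]; apply: NNPP => noMax.
have step (a : {a | P a}) : exists b : {a | P a},
    le (sval a) (sval b) /\ ~ le (sval b) (sval a).
  case: a => a Pa /=; apply: NNPP => H; apply: noMax; exists a; split=> // b Pb ab.
  by apply: NNPP => nba; apply: H; exists (exist _ b Pb).
pose g a := sval (constructive_indefinite_description _ (step a)).
have gP a : le (sval a) (sval (g a)) /\ ~ le (sval (g a)) (sval a).
  by rewrite /g; case: constructive_indefinite_description.
pose f n := sval (iter n g (exist _ a0 Pa0)).
have [|n] := acc f; last by case: (gP (iter n g (exist _ a0 Pa0))).
by move=> n; split; [exact: (svalP (iter n g _))|case: (gP (iter n g (exist _ a0 Pa0)))].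
Qed.

(** * Submodules: sums, multiples, and products with powers of an ideal *)

Section Submodules.
Variables (R : comPzRingType) (T : lmodType R).
Implicit Types (A B C E F K N P Q V W X Y : T -> Prop) (I J : R -> Prop).

Lemma submod0 A : is_submodule A -> A 0. Proof. by case. Qed.
Lemma submodD A x y : is_submodule A -> A x -> A y -> A (x + y).
Proof. by case=> _ H _; apply: H. Qed.
Lemma submodZ A a x : is_submodule A -> A x -> A (a *: x).
Proof. by case=> _ _ H; apply: H. Qed.
Lemma submodN A x : is_submodule A -> A x -> A (- x).
Proof. by move=> sA Ax; rewrite -scaleN1r; apply: submodZ. Qed.
Lemma submodB A x y : is_submodule A -> A x -> A y -> A (x - y).
Proof. by move=> sA Ax Ay; apply: submodD => //; apply: submodN. Qed.

Lemma submod_sum A n (f : 'I_n -> T) :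
  is_submodule A -> (forall i, A (f i)) -> A (\sum_(i < n) f i).
Proof.
move=> sA Af; apply: (big_ind A) => //; first exact: submod0.
by move=> x y; apply: submodD.
Qed.

Lemma submod_inter A B : is_submodule A -> is_submodule B -> is_submodule (interS A B).
Proof.
move=> sA sB; split=> [|x y [Ax Bx] [Ay By]|a x [Ax Bx]].
- by split; apply: submod0.
- by split; apply: submodD.
- by split; apply: submodZ.
Qed.

Lemma submod_colon A a : is_submodule A -> is_submodule (fun x => A (a *: x)).
Proof.
move=> sA; split=> [|x y Ax Ay|b x Ax].
- by rewrite scaler0; apply: submod0.
- by rewrite scalerDr; apply: submodD.
- by rewrite scalerA mulrC -scalerA; apply: submodZ.
Qed.

Lemma submod_zero : is_submodule (fun x : T => x = 0).
Proof.
by split=> [|x y -> ->|a x ->] //; rewrite ?addr0 ?scaler0.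
Qed.

Lemma submod_full : is_submodule (fun _ : T => True).
Proof. by []. Qed.

Definition scal z N : T -> Prop := fun x => exists2 m, N m & x = z *: m.

Lemma submod_scal z N : is_submodule N -> is_submodule (scal z N).
Proof.
move=> sN; split=> [|x y [m Nm ->] [m' Nm' ->]|a x [m Nm ->]].
- by exists 0; rewrite ?scaler0 //; apply: submod0.
- by exists (m + m'); rewrite ?scalerDr //; apply: submodD.
- by exists (a *: m); [apply: submodZ|rewrite !scalerA mulrC].
Qed.

Lemma submod_add A B : is_submodule A -> is_submodule B -> is_submodule (addS A B).
Proof.
move=> sA sB; split=> [|x y [u [v [Au Bv ->]]] [u' [v' [Au' Bv' ->]]]|a x [u [v [Au Bv ->]]]].
- by exists 0, 0; rewrite addr0; split=> //; apply: submod0.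
- by exists (u + u'), (v + v'); rewrite addrACA; split=> //; apply: submodD.
- by exists (a *: u), (a *: v); rewrite scalerDr; split=> //; apply: submodZ.
Qed.

Lemma addS_intro A B x y : A x -> B y -> addS A B (x + y).
Proof. by move=> Ax By; exists x, y. Qed.

Lemma addSl A B : is_submodule B -> subS A (addS A B).
Proof. by move=> sB x Ax; exists x, 0; rewrite addr0; split=> //; apply: submod0. Qed.

Lemma addSr A B : is_submodule A -> subS B (addS A B).
Proof. by move=> sA x Bx; exists 0, x; rewrite add0r; split=> //; apply: submod0. Qed.

Lemma addS_min A B C :
  is_submodule C -> subS A C -> subS B C -> subS (addS A B) C.
Proof. by move=> sC AC BC x [u [v [Au Bv ->]]]; apply: submodD; auto. Qed.

Lemma addS_mono A B A' B' : subS A A' -> subS B B' -> subS (addS A B) (addS A' B').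
Proof. by move=> AA BB x [u [v [Au Bv ->]]]; apply: addS_intro; auto. Qed.

Lemma addSC A B : addS A B = addS B A.
Proof.
by apply: predext => x [u [v [Au Bv ->]]]; rewrite addrC; apply: addS_intro.
Qed.

Lemma addSA A B C : addS A (addS B C) = addS (addS A B) C.
Proof.
apply: predext => x.
- move=> [u [_ [Au [v [w [Bv Cw ->]]] ->]]].
  by rewrite addrA; apply: addS_intro => //; apply: addS_intro.
- move=> [_ [w [[u [v [Au Bv ->]]] Cw ->]]].
  by rewrite -addrA; apply: addS_intro => //; apply: addS_intro.
Qed.

Lemma addSACA A B C D : addS (addS A B) (addS C D) = addS (addS A C) (addS B D).
Proof. by rewrite !addSA -(addSA A B C) (addSC B C) addSA. Qed.

Lemma add0S A : addS (fun x => x = 0) A = A.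
Proof.
apply: predext => [x [_ [v [-> Av ->]]]|x Ax]; first by rewrite add0r.
by exists 0, x; rewrite add0r.
Qed.

Lemma addS0 A : addS A (fun x => x = 0) = A.
Proof. by rewrite addSC add0S. Qed.

Lemma scal_add z A B : scal z (addS A B) = addS (scal z A) (scal z B).
Proof.
apply: predext => x.
- by move=> [_ [u [v [Au Bv ->]]] ->]; rewrite scalerDr; apply: addS_intro; eexists; eauto.
- move=> [_ [_ [[u Au ->] [v Bv ->] ->]]].
  by exists (u + v); rewrite ?scalerDr //; apply: addS_intro.
Qed.

Lemma prodIM_mem I V a v : I a -> V v -> prodIM I V (a *: v).
Proof.
move=> Ia Vv; exists 1%N, (fun=> a), (fun=> v); split=> //.
by rewrite big_ord1.
Qed.

Lemma prodIM_min I V N :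
  is_submodule N -> (forall a v, I a -> V v -> N (a *: v)) -> subS (prodIM I V) N.
Proof.
by move=> sN H x [n [a [v [Ia Vv ->]]]]; apply: submod_sum => // i; apply: H.
Qed.

Lemma submod_prodIM I V : is_submodule V -> is_submodule (prodIM I V).
Proof.
move=> sV; split.
- by exists 0%N, (fun=> 0), (fun=> 0); split; try (by case); rewrite big_ord0.
- move=> _ _ [n [a [v [Ia Vv ->]]]] [n' [a' [v' [Ia' Vv' ->]]]].
  exists (n + n')%N, (fun i => match split i with inl j => a j | inr j => a' j end),
    (fun i => match split i with inl j => v j | inr j => v' j end).
  split=> [i|i|]; try by case: (split i).
  rewrite big_split_ord /=; congr (_ + _); apply: eq_bigr => i _.
    by rewrite -/(unsplit (inl i)) unsplitK.
  by rewrite -/(unsplit (inr i)) unsplitK.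
- move=> b _ [n [a [v [Ia Vv ->]]]].
  exists n, a, (fun i => b *: v i); split=> // [i|]; first exact: submodZ.
  by rewrite scaler_sumr; apply: eq_bigr => i _; rewrite !scalerA mulrC.
Qed.

Lemma prodIM_mono I V W : subS V W -> subS (prodIM I V) (prodIM I W).
Proof. by move=> VW x [n [a [v [Ia Vv ->]]]]; exists n, a, v; split; auto. Qed.

Lemma prodIM_sub I V : is_submodule V -> subS (prodIM I V) V.
Proof. by move=> sV; apply: prodIM_min => // a v _; apply: submodZ. Qed.

Lemma prodIM_addS I A B : is_submodule A -> is_submodule B ->
  prodIM I (addS A B) = addS (prodIM I A) (prodIM I B).
Proof.
move=> sA sB; apply: predext.
- apply: prodIM_min => [|a _ Ia [u [v [Au Bv ->]]]].
    by apply: submod_add; apply: submod_prodIM.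
  by rewrite scalerDr; apply: addS_intro; apply: prodIM_mem.
- apply: addS_min; first by apply/submod_prodIM/submod_add.
    by apply: prodIM_mono; apply: addSl.
  by apply: prodIM_mono; apply: addSr.
Qed.

Lemma prodIM_scal I z V : is_submodule V ->
  prodIM I (scal z V) = scal z (prodIM I V).
Proof.
move=> sV; apply: predext.
- apply: prodIM_min => [|a _ Ia [v Vv ->]].
    by apply/submod_scal/submod_prodIM.
  by exists (a *: v); [apply: prodIM_mem|rewrite !scalerA mulrC].
- move=> _ [w Iw ->]; move: w Iw; apply: prodIM_min.
    by apply/submod_colon/submod_prodIM/submod_scal.
  move=> a v Ia Vv; rewrite scalerA mulrC -scalerA.
  by apply: prodIM_mem => //; exists v.
Qed.

Lemma prodIMC I J V : is_submodule V ->
  prodIM I (prodIM J V) = prodIM J (prodIM I V).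
Proof.
have half I1 I2 : is_submodule V ->
    subS (prodIM I1 (prodIM I2 V)) (prodIM I2 (prodIM I1 V)).
  move=> sV; have s2 : is_submodule (prodIM I2 (prodIM I1 V)).
    by do 2!apply: submod_prodIM.
  apply: prodIM_min => // a w Ia; move: w; apply: prodIM_min.
    exact: submod_colon.
  move=> b v Ib Vv; rewrite scalerA mulrC -scalerA.
  by apply: prodIM_mem => //; apply: prodIM_mem.
by move=> sV; apply: predext; apply: half.
Qed.

Lemma submod_powIM I n V : is_submodule V -> is_submodule (powIM I n V).
Proof. by move=> sV; elim: n => //= n IH; apply: submod_prodIM. Qed.

Lemma powIM_mono I n V W : subS V W -> subS (powIM I n V) (powIM I n W).
Proof. by move=> VW; elim: n => //= n IH; apply: prodIM_mono. Qed.

Lemma powIMD I m n V : powIM I (m + n) V = powIM I m (powIM I n V).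
Proof. exact: iterD. Qed.

Lemma powIM_sub I n V : is_submodule V -> subS (powIM I n V) V.
Proof.
move=> sV; elim: n => //= n IH x Ix; apply: IH.
exact: (prodIM_sub (submod_powIM _ _ sV) Ix).
Qed.

Lemma powIM_le I m n V : is_submodule V -> (m <= n)%N ->
  subS (powIM I n V) (powIM I m V).
Proof.
move=> sV /subnK <-; rewrite powIMD; apply: powIM_sub; exact: submod_powIM.
Qed.

Lemma powIM_addS I n A B : is_submodule A -> is_submodule B ->
  powIM I n (addS A B) = addS (powIM I n A) (powIM I n B).
Proof.
move=> sA sB; elim: n => //= n ->.
by rewrite prodIM_addS //; apply: submod_powIM.
Qed.

Lemma powIM_scal I n z V : is_submodule V ->
  powIM I n (scal z V) = scal z (powIM I n V).
Proof.
move=> sV; elim: n => //= n ->.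
by rewrite prodIM_scal //; apply: submod_powIM.
Qed.

Lemma powIM_prodIM I J n V : is_submodule V ->
  powIM I n (prodIM J V) = prodIM J (powIM I n V).
Proof.
move=> sV; elim: n => //= n ->.
by rewrite prodIMC //; apply: submod_powIM.
Qed.

End Submodules.

(** * Spans of finite lists *)

Section Generators.
Variables (R : comPzRingType) (T : lmodType R).
Implicit Types (s : seq T).

Fixpoint gen s : T -> Prop :=
  if s is t :: s' then fun x => exists r b, gen s' b /\ x = r *: t + b
  else fun x => x = 0.

Lemma gen_span s x :
  gen s x <-> exists c : 'I_(size s) -> R, x = \sum_(i < size s) c i *: s`_i.
Proof.
elim: s x => [|a s IH] x /=.
  split=> [->|[c ->]]; last by rewrite big_ord0.
  by exists (fun=> 0); rewrite big_ord0.
split=> [[r [b [/IH[c ->] ->]]]|[c ->]].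
  exists (fun i => if unlift ord0 i is Some j then c j else r).
  rewrite big_ord_recl /= unlift_none; congr (_ + _).
  by apply: eq_bigr => i _; rewrite liftK.
rewrite big_ord_recl /=; exists (c ord0), (\sum_(i < size s) c (lift ord0 i) *: s`_i).
by split=> //; apply/IH; exists (fun i => c (lift ord0 i)).
Qed.

Lemma submod_gen s : is_submodule (gen s).
Proof.
elim: s => [|a s IH] /=; first exact: submod_zero.
split.
- by exists 0, 0; rewrite scale0r addr0; split=> //; apply: submod0.
- move=> _ _ [r [b [gb ->]]] [r' [b' [gb' ->]]]; exists (r + r'), (b + b').
  by rewrite scalerDl addrACA; split=> //; apply: submodD.
- move=> c _ [r [b [gb ->]]]; exists (c * r), (c *: b).
  by rewrite scalerDr scalerA; split=> //; apply: submodZ.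
Qed.

Lemma mem_gen s i : (i < size s)%N -> gen s s`_i.
Proof.
elim: s i => //= a s IH [|i] si /=.
  by exists 1, 0; rewrite scale1r addr0; split=> //; apply: submod0 (submod_gen s).
by exists 0, s`_i; rewrite scale0r add0r; split=> //; apply: IH.
Qed.

Lemma gen_consr t s : subS (gen s) (gen (t :: s)).
Proof. by move=> x gx; exists 0, x; rewrite scale0r add0r. Qed.

Lemma gen_consl t s : gen (t :: s) t.
Proof. exact: (@mem_gen (t :: s) 0%N). Qed.

End Generators.

(** * Ideals of a Noetherian ring *)

Section Ideals.
Variable R : comPzRingType.
Hypothesis noeR : noetherian_ring R.
Implicit Types (I J : R -> Prop).

Lemma ideal0 I : is_ideal I -> I 0. Proof. by case. Qed.
Lemma idealD I x y : is_ideal I -> I x -> I y -> I (x + y).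
Proof. by case=> _ H _; apply: H. Qed.
Lemma idealM I a x : is_ideal I -> I x -> I (a * x).
Proof. by case=> _ _ H; apply: H. Qed.
Lemma idealN I x : is_ideal I -> I x -> I (- x).
Proof. by move=> iI Ix; rewrite -mulN1r; apply: idealM. Qed.

Lemma noetherian_gen I : is_ideal I -> exists s : seq R^o, I = gen s.
Proof.
move=> /noeR[s sP]; exists s.
by apply: predext => x; rewrite gen_span => /sP.
Qed.

Lemma ideal_acc (X : nat -> R -> Prop) :
  (forall s, is_ideal (X s)) -> (forall s, subS (X s) (X s.+1)) ->
  exists s0, forall s, subS (X s) (X s0).
Proof.
move=> iX XS; have Xle := chain_le XS.
pose U x := exists s, X s x.
have iU : is_ideal U.
  split; first by exists 0%N; apply: ideal0.
  - move=> x y [s Xs] [t Xt]; exists (maxn s t); apply: idealD => //.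
      by apply: Xle Xs; rewrite leq_maxl.
    by apply: Xle Xt; rewrite leq_maxr.
  - by move=> a x [s Xs]; exists s; apply: idealM.
have [g Ug] := noetherian_gen iU.
suff [s0 s0P] : exists s0, subS (gen g) (X s0).
  by exists s0 => s x Xx; apply: s0P; rewrite -Ug; exists s.
have : subS (gen g) U by rewrite Ug.
elim: g {Ug} => [|a g IH] Ug.
  by exists 0%N => x /= ->; apply: ideal0.
have [s sP] : exists s, subS (gen g) (X s).
  by apply: IH => x gx; apply/Ug/gen_consr.
have [t Xta] : U a by apply/Ug/gen_consl.
exists (maxn s t) => x /= [r [b [gb ->]]]; apply: idealD => //.
  by apply: idealM => //; apply: Xle Xta; rewrite leq_maxr.
by apply: Xle (sP _ gb); rewrite leq_maxl.
Qed.

End Ideals.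

(** * Chain conditions for submodules and Rees families, and the Artin-Rees lemma *)

Section ChainConditions.
Variables (R : comPzRingType) (T : lmodType R).
Hypothesis noeR : noetherian_ring R.
Hypothesis fgT : finitely_generated_module T.
Implicit Types (A B C E F K N P Q V W : T -> Prop) (I J : R -> Prop).

(** Induction on the generators of [T]. The coefficients of the first generator form an ascending
    chain of ideals, and two elements with the same coefficient differ by a combination of the other
    generators. *)
Lemma submod_acc (X : nat -> T -> Prop) :
  (forall s, is_submodule (X s)) -> (forall s, subS (X s) (X s.+1)) ->
  exists s0, forall s, subS (X s) (X s0).
Proof.
move=> sX XS; have Xle := chain_le XS.
have [ts tsP] := fgT.
suff [s0 s0P] : exists s0, forall s x, gen ts x -> X s x -> X s0 x.
  by exists s0 => s x; apply: s0P => //; apply/gen_span.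
elim: ts {tsP} => [|t ts [s2 s2P]].
  by exists 0%N => s x /= -> _; apply: submod0.
pose A s r := exists b, gen ts b /\ X s (r *: t + b).
have [s1 s1P] : exists s0, forall s, subS (A s) (A s0).
  apply: ideal_acc => // [s|s r [b [gb Xb]]]; last first.
    by exists b; split=> //; apply: XS.
  have sg := submod_gen ts; split.
  - by exists 0; rewrite scale0r addr0; split; apply: submod0.
  - move=> r r' [b [gb Xb]] [b' [gb' Xb']]; exists (b + b'); split; first exact: submodD.
    by rewrite scalerDl addrACA; apply: submodD.
  - move=> a r [b [gb Xb]]; exists (a *: b); split; first exact: submodZ.
    by rewrite -scalerA -scalerDr; apply: submodZ.
exists (maxn s1 s2) => s _ [r [b [gb ->]]] Xx.
have [|b' [gb' Xb']] := s1P s r; first by exists b.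
have {}Xb' : X (maxn s1 s2) (r *: t + b') by apply: Xle Xb'; rewrite leq_maxl.
have -> : r *: t + b = (r *: t + b') + (b - b') by rewrite addrACA subrr addr0.
apply: submodD => //; apply: (Xle s2); first by rewrite leq_maxr.
pose m := maxn s (maxn s1 s2).
apply: (s2P m); first exact: (submodB (submod_gen ts)).
have -> : b - b' = (r *: t + b) - (r *: t + b') by rewrite opprD addrACA subrr add0r.
apply: submodB => //; first by apply: Xle Xx; rewrite leq_maxl.
by apply: Xle Xb'; rewrite leq_maxr.
Qed.

(** For submodules [X n] this makes their direct sum a graded submodule over the Rees algebra of
    [I]. *)
Definition stable I (X : nat -> T -> Prop) :=
  forall n a x, I a -> X n x -> X n.+1 (a *: x).

Lemma stable_prodIM I X n : (forall n, is_submodule (X n)) -> stable I X ->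
  subS (prodIM I (X n)) (X n.+1).
Proof. by move=> sX IX; apply: prodIM_min => // a v; apply: IX. Qed.

Lemma stable_powIM_shift I X k n : (forall n, is_submodule (X n)) -> stable I X ->
  subS (powIM I k (X n)) (X (k + n)%N).
Proof.
move=> sX IX; elim: k => [|k IH] x //= H.
by rewrite addSn; apply: (stable_prodIM sX IX); apply: (prodIM_mono IH).
Qed.

Lemma stable_powIM I V : stable I (fun n => powIM I n V).
Proof. by move=> n a x; apply: prodIM_mem. Qed.

Lemma stable_inter I X Y : stable I X -> stable I Y ->
  stable I (fun n => interS (X n) (Y n)).
Proof. by move=> IX IY n a x Ia [Xx Yx]; split; [apply: IX|apply: IY]. Qed.

Lemma uniform_bound (P : nat -> nat -> Prop) m :
  (forall j s s', (s <= s')%N -> P j s -> P j s') -> (forall j, exists s, P j s) ->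
  exists s, forall j, (j < m)%N -> P j s.
Proof.
move=> mono H; elim: m => [|m [s0 IH]]; first by exists 0%N.
have [s1 s1P] := H m; exists (maxn s0 s1) => j.
rewrite ltnS leq_eqVlt => /orP[/eqP->|jm].
  by apply: mono s1P; apply: leq_maxr.
by apply: mono (IH j jm); apply: leq_maxl.
Qed.

(* Filtering [I^n V], [I = I' + (a)], by the power of [a] reduces an [I]-stable
   family to the [I']-stable families of its leading coefficients, as in
   Hilbert's basis theorem. *)
Lemma rees_acc (l : seq R^o) V (X : nat -> nat -> T -> Prop) :
  is_submodule V ->
  (forall s n, is_submodule (X s n)) -> (forall s, stable (gen l) (X s)) ->
  (forall s n, subS (X s n) (X s.+1 n)) ->
  exists s0, forall s n x, powIM (gen l) n V x -> X s n x -> X s0 n x.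
Proof.
move=> sV; elim: l X => [|a l IH] X sX IX XS.
  have [s0 s0P] := @submod_acc (fun s => X s 0%N) (fun s => sX s 0%N) (fun s => XS s 0%N).
  exists s0 => s [|n] x; first by move=> _; exact: (s0P s).
  move=> H _; suff -> : x = 0 by apply: submod0 (sX _ _).
  move: x H; apply: prodIM_min; first exact: submod_zero.
  by move=> b v -> _; rewrite scale0r.
set I' := gen l; set I := gen (a :: l).
have I'I : subS I' I by exact: gen_consr.
have Ia : I a by exact: gen_consl.
(* Unfolded, [Q j k] is the sum of $a^i I'^{k+j-i} V$ over $i<j$: the elements of $I^{k+j}V$
   expressible with degree below $j$ in $a$. *)
pose Q := fix Q j k := if j is j'.+1 then
  addS (Q j' k.+1) (scal (a ^+ j') (powIM I' k.+1 V)) else (fun x : T => x = 0).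
have sa j k : is_submodule (scal (a ^+ j) (powIM I' k V)).
  by apply/submod_scal/submod_powIM.
have sQ j k : is_submodule (Q j k).
  by elim: j k => [|j IHj] k; [exact: submod_zero|apply: submod_add; [exact: IHj|exact: sa]].
have sa_a j k : subS (scal a (scal (a ^+ j) (powIM I' k V)))
    (scal (a ^+ j.+1) (powIM I' k V)).
  by move=> _ [_ [m Im ->] ->]; exists m; rewrite // scalerA exprS.
have sa_I' j k b x : I' b -> scal (a ^+ j) (powIM I' k V) x ->
    scal (a ^+ j) (powIM I' k.+1 V) (b *: x).
  move=> I'b [m Im ->]; exists (b *: m); first exact: prodIM_mem.
  by rewrite !scalerA mulrC.
have Qa j k : subS (scal a (Q j k)) (Q j.+1 k).
  elim: j k => [|j IHj] k /=.
    by move=> _ [_ -> ->]; rewrite scaler0; exact: (submod0 (sQ 1%N k)).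
  rewrite scal_add; apply: addS_mono; last exact: (@sa_a j k.+1).
  exact: IHj.
have QI' j k b x : I' b -> Q j k x -> Q j k.+1 (b *: x).
  move=> I'b; elim: j k x => [|j IHj] k x /=; first by move=> ->; rewrite scaler0.
  move=> [u [v [Qu av ->]]]; rewrite scalerDr.
  by apply: addS_intro; [exact: IHj|exact: (@sa_I' j k.+1)].
(* The coefficients of $a^j$ in elements of [X s (k + j)], modulo terms of lower degree. For fixed
   [s] and [j] they form an [I']-stable family; multiplication by $a$ makes them grow with [j]. *)
pose Y s j k m := addS (X s (k + j)%N) (Q j k) (a ^+ j *: m).
have sY s j k : is_submodule (Y s j k) by apply/submod_colon/submod_add; [exact: sX|exact: sQ].
have IY s j : stable I' (Y s j).
  move=> k b m I'b [u [v [Xu Qv E]]]; rewrite /Y scalerA mulrC -scalerA E scalerDr addSn.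
  by apply: addS_intro; [apply: IX => //; apply: I'I|apply: QI'].
have YS s j k : subS (Y s j k) (Y s.+1 j k).
  by move=> m; apply: addS_mono => // x; apply: XS.
have Yj s j k : subS (Y s j k) (Y s j.+1 k).
  move=> m [u [v [Xu Qv E]]]; rewrite /Y exprS -scalerA E scalerDr addnS.
  by apply: addS_intro; [apply: IX|apply: Qa; exists v].
(* The diagonal chain, where [s] and [j] grow together, settles all [j >= sd]; the finitely many
   [j < sd] are settled separately by [s1]. *)
have [sd sdP] := IH (fun s => Y s s) (fun s => sY s s) (fun s => IY s s)
  (fun s k x H => @Yj s.+1 s k x (@YS s s k x H)).
have Yle s s' j j' k : (s <= s')%N -> (j <= j')%N -> subS (Y s j k) (Y s' j' k).
  move=> ss' jj' x Yx; apply: (chain_le (X := fun j => Y s' j k) _ jj') => //.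
  by apply: (chain_le (X := fun s => Y s j k) _ ss').
have [s1 s1P] : exists s0, forall j, (j < sd)%N ->
    forall s k x, powIM I' k V x -> Y s j k x -> Y s0 j k x.
  apply: uniform_bound => [j s s' ss' H t k x Ix Yx|j]; first by apply: Yle (H _ _ _ Ix Yx).
  exact: (IH (fun s => Y s j) (fun s => sY s j) (fun s => IY s j) (fun s => @YS s j)).
pose s2 := maxn sd s1; exists s2 => s.
wlog s2s : s / (s2 <= s)%N => [H n x Ix Xx|].
  apply: (H (maxn s2 s)); rewrite ?leq_maxl //.
  by apply: (chain_le (X := fun s => X s n) _ (leq_maxr s2 s)).
have Y2 j k x : powIM I' k V x -> Y s j k x -> Y s2 j k x.
  move=> Ix Yx; case: (ltnP j sd) => jsd.
    by apply: (Yle s1 _ j) (s1P _ jsd _ _ _ Ix Yx); rewrite ?leq_maxr.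
  apply: (Yle sd _ sd) (sdP (maxn s j) _ _ Ix _) => //; first by rewrite leq_maxl.
  by apply: Yle Yx; [exact: leq_maxl|exact: leq_maxr].
pose P j k := addS (Q j k) (scal (a ^+ j) (powIM I' k V)).
have sP j k : is_submodule (P j k) by apply: submod_add; [exact: sQ|exact: sa].
(* Induction on the degree [j] in $a$: an element of [X s2] with the same leading coefficient is
   subtracted, and the difference lies in [Q], where [Q j.+1 k] is [P j k.+1] by definition. *)
have X2 : forall j k x, P j k x -> X s (k + j)%N x -> X s2 (k + j)%N x.
  have lead j k q m : Q j k q -> powIM I' k V m -> X s (k + j)%N (q + a ^+ j *: m) ->
      addS (X s2 (k + j)%N) (Q j k) (a ^+ j *: m).
    move=> Qq Im Xx; apply: Y2 => //.
    by exists (q + a ^+ j *: m), (- q); rewrite addrAC subrr add0r; split=> //; apply: submodN.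
  elim=> [|j IHj] k _ [q [_ [Qq [m Im ->] ->]]] Xx;
    have [x' [q' [Xx' Qq' E]]] := lead _ _ _ _ Qq Im Xx; rewrite {}E in Xx *.
    by rewrite /= in Qq Qq'; rewrite Qq Qq' add0r addr0.
  rewrite addrCA; apply: submodD => //.
  rewrite addnS -addSn; apply: IHj; first exact: (submodD (sQ j.+1 k)).
  have -> : q + q' = (q + (x' + q')) - x' by rewrite addrCA addrC addrK.
  rewrite addSn -addnS; apply: submodB => //.
  by apply: (chain_le (X := fun s => X s (k + j.+1)%N) _ s2s).
suff IP n : subS (powIM I n V) (P n 0%N) by move=> n x /IP; apply: X2.
elim: n => [|n IHn] x.
  by move=> Vx; apply: addSr => //; exists x; rewrite // expr0 scale1r.
move=> H; have {H} : prodIM I (P n 0%N) x by apply: prodIM_mono H.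
move: x; apply: (prodIM_min (sP n.+1 0%N)) => _ x [r [b [I'b ->]]].
move=> [u [_ [Qu [v Iv ->] ->]]]; set av := _ *: v.
have Pav : scal (a ^+ n) (powIM I' 0%N V) av by exists v.
rewrite scalerDl -scalerA; apply: submodD; first exact: sP.
  apply: submodZ; first exact: sP.
  by rewrite scalerDr; apply: addS_intro; [apply: Qa; exists u|apply: sa_a; exists av].
rewrite scalerDr; apply: (addSl (sa n.+1 0%N)).
by apply: (addS_intro (B := scal _ (powIM I' 1%N V))); [apply: QI'|apply: sa_I'].
Qed.

(** The families [W s] generated by the intersections [Z] in degrees up to [s] ascend to [Z]; by
    [rees_acc] the chain stops, so [Z] is generated in degrees up to [c0]. Stating this for every
    larger [c] allows several bounds to be merged. *)
Lemma artin_rees I V (X : nat -> T -> Prop) : is_ideal I -> is_submodule V ->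
  (forall n, is_submodule (X n)) -> stable I X ->
  exists c0, forall c, (c0 <= c)%N -> forall n,
    subS (interS (X (n + c)%N) (powIM I (n + c) V))
         (powIM I n (interS (X c) (powIM I c V))).
Proof.
move=> iI sV sX IX; have [l Il] := noetherian_gen noeR iI.
pose Z n := interS (X n) (powIM I n V).
have sZ n : is_submodule (Z n) by apply: submod_inter => //; apply: submod_powIM.
have IZ : stable I Z by apply: stable_inter => //; apply: stable_powIM.
(* For [n <= s] truncated subtraction gives [W s n = Z n]. *)
pose W s n := powIM I (n - s) (Z (minn n s)).
have sW s n : is_submodule (W s n) by apply: submod_powIM.
have WE n : W n n = Z n by rewrite /W subnn minnn.
have IW s : stable I (W s).
  move=> n a x Ia; rewrite /W; have [ns|] := boolP (n < s)%N; last rewrite -leqNgt => ns.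
    rewrite (eqP (ltnW ns)) (minn_idPl (ltnW ns)) (eqP ns) (minn_idPl ns).
    exact: IZ.
  rewrite subSn // (minn_idPr (leqW ns)) (minn_idPr ns).
  exact: prodIM_mem.
have WS s n : subS (W s n) (W s.+1 n).
  rewrite /W; have [sn|] := boolP (s < n)%N; last rewrite -leqNgt => sn.
    rewrite (minn_idPr sn) (minn_idPr (ltnW sn)) -(subnSK sn) -addn1 powIMD.
    by apply: powIM_mono; apply: stable_prodIM.
  by rewrite (eqP sn) (minn_idPl sn) (eqP (leqW sn)) (minn_idPl (leqW sn)).
rewrite Il in IW; have [c0 c0P] := rees_acc sV sW IW WS.
exists c0 => c c0c n x Zx.
have Wx : W (n + c)%N (n + c)%N x by rewrite WE.
have {}Wx : W c0 (n + c)%N x.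
  by apply: c0P Wx; rewrite -Il; case: Zx.
have := chain_le (X := fun s => W s (n + c)%N) (fun s => @WS s (n + c)%N) c0c Wx.
by rewrite /W addnK (minn_idPr (leq_addl n c)).
Qed.

End ChainConditions.

(** * Families of the form $E+I^{n-c}F$ and their closure properties *)

Section GoodFamilies.
Variables (R : comPzRingType) (T : lmodType R).
Hypothesis noeR : noetherian_ring R.
Hypothesis fgT : finitely_generated_module T.
Variable I : R -> Prop.
Hypothesis iI : is_ideal I.
Implicit Types (A B C D E F K N P Q V W Z : T -> Prop) (X Y : nat -> T -> Prop).

Lemma artin_rees_const A V : is_submodule A -> is_submodule V ->
  exists c0, forall c, (c0 <= c)%N -> forall n,
    subS (interS A (powIM I (n + c) V)) (powIM I n (interS A (powIM I c V))).
Proof.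
move=> sA sV; apply: (artin_rees noeR fgT (X := fun=> A)) => //.
by move=> n a x _; apply: submodZ.
Qed.

Lemma powIM_add_sub A B Z n c : is_submodule A -> is_submodule B ->
  subS Z (addS A (powIM I c B)) -> subS (powIM I n Z) (addS A (powIM I (n + c) B)).
Proof.
move=> sA sB ZAB x /(powIM_mono ZAB); rewrite powIM_addS //; last exact: submod_powIM.
by rewrite powIMD; apply: addS_mono => //; apply: powIM_sub.
Qed.

(** If $x=a+b=c'+d$, then $a-c'=d-b$ lies in $(A+C)\cap I^{n+c}(B+D)$. Artin-Rees gives $a-c'=a_1-e$
    with some $z\in I^nZ$ close to both $a_1\in A$ and $e\in C$. Then $a-a_1=c'-e$ is in $A\cap C$,
    and Artin-Rees again puts the rest, which lies in $I^{n+c}B\cap I^{n+c}D$, into $I^nZ$. *)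
Lemma add_powIM_inter A B C D :
  is_submodule A -> is_submodule B -> is_submodule C -> is_submodule D ->
  exists c, forall n,
    interS (addS A (powIM I (n + c) B)) (addS C (powIM I (n + c) D)) =
    addS (interS A C)
      (powIM I n (interS (addS A (powIM I c B)) (addS C (powIM I c D)))).
Proof.
move=> sA sB sC sD.
have sp n V : is_submodule V -> is_submodule (powIM I n V) by exact: submod_powIM.
have sAC : is_submodule (addS A C) by apply: submod_add.
have sBD : is_submodule (addS B D) by apply: submod_add.
have [c1 AR1] := artin_rees_const sAC sBD.
have [c2 AR2] := artin_rees noeR fgT (X := fun n => powIM I n D) iI sB
  (fun n => sp n D sD) (@stable_powIM _ _ I D).
pose c := maxn c1 c2; exists c => n.
set Z := interS (addS A (powIM I c B)) (addS C (powIM I c D)).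
have sAB k : is_submodule (addS A (powIM I k B)) by apply: submod_add => //; apply: sp.
have sCD k : is_submodule (addS C (powIM I k D)) by apply: submod_add => //; apply: sp.
have sZ : is_submodule Z by apply: submod_inter.
have sAiC : is_submodule (interS A C) by apply: submod_inter.
have ZI : subS (powIM I n Z) (interS (addS A (powIM I (n + c) B)) (addS C (powIM I (n + c) D))).
  by move=> x Zx; split; apply: (powIM_add_sub (c := c) _ _ _ Zx) => // y [].
apply: predext => [x [[a [b [Aa Bb Eab]]] [c' [d [Cc Dd Ecd]]]]|]; last first.
  apply: addS_min => //; first by apply: submod_inter.
  by move=> x [Ax Cx]; split; apply: addSl => //; apply: sp.
(* The differences $a-c$ for which such a $z$ exists, with [k] in place of [n]. The bound variable
   [c] hides the constant, hence [maxn c1 c2] in full. *)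
pose Phi k y := exists z a c, [/\ powIM I k Z z, A a, C c & y = a - c /\
   powIM I (k + maxn c1 c2) B (z - a) /\ powIM I (k + maxn c1 c2) D (z - c)].
have sPhi k : is_submodule (Phi k).
  have sB' := sp (k + maxn c1 c2)%N B sB; have sD' := sp (k + maxn c1 c2)%N D sD.
  have sZ' := sp k Z sZ.
  split.
  - exists 0, 0, 0; rewrite !subr0.
    by split; [exact: submod0|exact: submod0|exact: submod0|split=> //; split; exact: submod0].
  - move=> _ _ [z [a1 [e [Zz Aa1 Ce [-> [Bz Dz]]]]]] [z' [a2 [e' [Zz' Aa2 Ce' [-> [Bz' Dz']]]]]].
    exists (z + z'), (a1 + a2), (e + e'); split; try exact: submodD.
    rewrite !opprD; split; first by rewrite addrACA.
    by rewrite !(addrACA z z'); split; apply: submodD.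
  - move=> t _ [z [a1 [e [Zz Aa1 Ce [-> [Bz Dz]]]]]].
    exists (t *: z), (t *: a1), (t *: e); split; try exact: submodZ.
    by rewrite -!scalerBr; split=> //; split; apply: submodZ.
have IPhi k : subS (powIM I k (interS (addS A C) (powIM I c (addS B D)))) (Phi k).
  elim: k => [|k IH] y.
    move=> [[a1 [e [Aa1 Ce ->]]]]; rewrite powIM_addS // => -[u [v [Bu Dv E]]].
    have Ez : a1 - u = - e + v.
      by rewrite -[a1](addrK e) E addrAC [u + v]addrC addrK addrC.
    exists (a1 - u), a1, (- e); rewrite opprK; split=> //.
    - split; first by apply: addS_intro => //; apply: submodN => //; apply: sp.
      by rewrite Ez; apply: addS_intro => //; apply: submodN.
    - exact: submodN.
    split=> //; split; first by rewrite addrAC subrr add0r; apply: submodN => //; apply: sp.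
    by rewrite Ez addrAC addNr add0r.
  move=> H; have {H} : prodIM I (Phi k) y by apply: prodIM_mono H.
  move: y; apply: prodIM_min => // t _ It [z [a1 [e [Zz Aa1 Ce [-> [Bz Dz]]]]]].
  exists (t *: z), (t *: a1), (t *: e); rewrite -!scalerBr; split; try exact: submodZ.
    exact: prodIM_mem.
  by split=> //; split; apply: prodIM_mem.
have [z [a1 [e [Zz Aa1 Ce [E [Bz Dz]]]]]] : Phi n (a - c').
  apply/IPhi/AR1; first exact: leq_maxl.
  split; first by apply: addS_intro => //; apply: submodN.
  rewrite powIM_addS //.
  have -> : a - c' = (- b) + d.
    by apply/eqP; rewrite subr_eq -addrA [d + _]addrC -Ecd Eab addrC addrK.
  by apply: addS_intro => //; apply: submodN => //; apply: sp.
have Ea : a - a1 = c' - e.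
  by apply/eqP; rewrite subr_eq addrAC -addrA -E addrC subrK.
have -> : x = (a - a1) + (z + (x - z - (a - a1))) by rewrite addrC -addrA subrK addrC subrK.
apply: addS_intro; first by split; [|rewrite Ea]; apply: submodB.
apply: submodD => //; first exact: sp.
have {}AR2 := AR2 c (leq_maxr _ _) n (x - z - (a - a1)).
apply: (powIM_mono _ (AR2 _)).
  by move=> y [Dy By]; split; apply: addSr.
have shift (u v w : T) : u + v - z - (u - w) = v - (z - w).
  by rewrite !opprB addrAC [u + v]addrC -[v + u + _]addrA [u + _]addrC subrK addrA.
split; last by rewrite Eab shift //; apply: submodB => //; apply: sp.
by rewrite Ea Ecd shift //; apply: submodB => //; apply: sp.
Qed.

(** If $jx=a+b$, then $b\in(A+jT)\cap I^{n+c}B$, which Artin-Rees places in $I^n(A+jZ)\subseteq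
    A+jI^nZ$. Subtracting the element of $I^nZ$ from $x$ leaves an element of $A:j$. *)
Lemma add_powIM_colon A B j : is_submodule A -> is_submodule B ->
  exists c, forall n,
    (fun x => addS A (powIM I (n + c) B) (j *: x)) =
    addS (fun x => A (j *: x))
      (powIM I n (fun x => addS A (powIM I c B) (j *: x))).
Proof.
move=> sA sB.
have sp n V : is_submodule V -> is_submodule (powIM I n V) by exact: submod_powIM.
have sAB k : is_submodule (addS A (powIM I k B)) by apply: submod_add => //; apply: sp.
have sjA : is_submodule (addS A (scal j (fun=> True))).
  by apply: submod_add => //; apply: submod_scal.
have [c AR] := artin_rees_const sjA sB; exists c => n.
set Z := fun x => addS A (powIM I c B) (j *: x).
have sZ : is_submodule Z by apply: submod_colon.
apply: predext => [x [a [b [Aa Bb E]]]|]; last first.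
  apply: addS_min; first exact: submod_colon.
    by move=> x Ax; apply: addSl => //; apply: sp.
  move=> x Zx; have : powIM I n (scal j Z) (j *: x) by rewrite powIM_scal //; exists x.
  move/(powIM_mono (W := addS A (powIM I c B))) => H.
  have {H} : powIM I n (addS A (powIM I c B)) (j *: x) by apply: H => _ [y Zy ->].
  rewrite powIM_addS //; last exact: sp.
  by rewrite powIMD; apply: addS_mono => //; apply: powIM_sub.
have : powIM I n (interS (addS A (scal j (fun=> True))) (powIM I c B)) b.
  apply: AR => //; split=> //; exists (- a), (j *: x); split; [exact: submodN|by exists x|].
  by rewrite E addKr.
have H : subS (interS (addS A (scal j (fun=> True))) (powIM I c B)) (addS A (scal j Z)).
  move=> _ [[u [_ [Au [y _ ->] ->]]] By]; apply: addS_intro => //; exists y => //.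
  exists (- u), (u + j *: y); split=> //; first exact: submodN.
  by rewrite addrA addNr add0r.
move/(powIM_mono H); rewrite powIM_addS //; last exact: submod_scal.
rewrite powIM_scal // => -[u [_ [/powIM_sub Au [z Zz ->] Eb]]].
exists (x - z), z; rewrite subrK; split=> //.
rewrite scalerBr E Eb addrA addrK; apply: submodD => //; exact: Au.
Qed.

(** The offset on the left avoids truncated subtraction; replacing [F] by $I^dF$ raises it by
    $d$. *)
Definition good X := exists c E F,
  [/\ is_submodule E, is_submodule F & forall n, X (n + c)%N = addS E (powIM I n F)].

Lemma good_add_powIM E F : is_submodule E -> is_submodule F ->
  good (fun n => addS E (powIM I n F)).
Proof. by move=> sE sF; exists 0%N, E, F; split=> // n; rewrite addn0. Qed.

Lemma good_shift X c d E F : is_submodule E -> is_submodule F ->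
  (forall n, X (n + c)%N = addS E (powIM I n F)) ->
  forall n, X (n + (d + c))%N = addS E (powIM I n (powIM I d F)).
Proof. by move=> sE sF XE n; rewrite addnA XE powIMD. Qed.

Lemma good_common X Y : good X -> good Y -> exists c E F E' F',
  [/\ is_submodule E, is_submodule F, is_submodule E', is_submodule F' &
    (forall n, X (n + c)%N = addS E (powIM I n F)) /\
    (forall n, Y (n + c)%N = addS E' (powIM I n F'))].
Proof.
move=> [c [E [F [sE sF XE]]]] [c' [E' [F' [sE' sF' YE]]]].
exists (c + c')%N, E, (powIM I c' F), E', (powIM I c F').
split=> //; try exact: submod_powIM; split; last exact: good_shift.
by rewrite addnC; apply: good_shift.
Qed.

Lemma good_inter X Y : good X -> good Y -> good (fun n => interS (X n) (Y n)).
Proof.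
move=> gX gY; have [c [A [B [C [D [sA sB sC sD [XE YE]]]]]]] := good_common gX gY.
have [d H] := add_powIM_inter sA sB sC sD.
exists (d + c)%N; do 2!eexists; split; last by move=> n; rewrite addnA XE YE.
  exact: submod_inter.
by apply: submod_inter; apply: submod_add => //; apply: submod_powIM.
Qed.

Lemma good_colon X j : good X -> good (fun n x => X n (j *: x)).
Proof.
move=> [c [A [B [sA sB XE]]]].
have [d H] := add_powIM_colon j sA sB.
exists (d + c)%N; do 2!eexists; split; last by move=> n; rewrite addnA XE.
  exact: submod_colon.
by apply: submod_colon; apply: submod_add => //; apply: submod_powIM.
Qed.

Lemma good_add X Y : good X -> good Y -> good (fun n => addS (X n) (Y n)).
Proof.
move=> gX gY; have [c [A [B [C [D [sA sB sC sD [XE YE]]]]]]] := good_common gX gY.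
exists c, (addS A C), (addS B D); split; try exact: submod_add.
by move=> n; rewrite XE YE powIM_addS // addSACA.
Qed.

Lemma good_scal X z : good X -> good (fun n => scal z (X n)).
Proof.
move=> [c [A [B [sA sB XE]]]]; exists c, (scal z A), (scal z B).
by split; try exact: submod_scal; move=> n; rewrite XE scal_add powIM_scal.
Qed.

Lemma good_prodIM J X : good X -> good (fun n => prodIM J (X n)).
Proof.
move=> [c [A [B [sA sB XE]]]]; exists c, (prodIM J A), (prodIM J B).
split; try exact: submod_prodIM; move=> n; rewrite XE powIM_prodIM //.
by rewrite prodIM_addS //; apply: submod_powIM.
Qed.

(* [E <= E' + I^n F'] is inherited by smaller [n], and
   [I^n F <= E' + I^n F'] by larger [n]. *)
Lemma good_subS X Y : good X -> good Y ->
  exists n0, (forall n, (n0 <= n)%N -> subS (X n) (Y n)) \/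
             (forall n, (n0 <= n)%N -> ~ subS (X n) (Y n)).
Proof.
move=> gX gY; have [c [E [F [E' [F' [sE sF sE' sF' [XE YE]]]]]]] := good_common gX gY.
have sY n : is_submodule (addS E' (powIM I n F')).
  by apply: submod_add => //; apply: submod_powIM.
have tail (P : nat -> Prop) n0 : (forall n, (n0 <= n)%N -> P (n + c)%N) ->
    forall n, (n0 + c <= n)%N -> P n.
  move=> H n le; rewrite -(@subnK c n); last by apply: leq_trans le; apply: leq_addl.
  by apply: H; rewrite leq_subRL ?[(c + _)%N]addnC //; apply: leq_trans le; apply: leq_addl.
case: (classic (exists n, ~ subS E (addS E' (powIM I n F')))) => [[n1 n1P]|HE].
  exists (n1 + c)%N; right; apply: tail => n le; rewrite XE YE => H; apply: n1P => x Ex.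
  apply: addS_mono (H x _) => //; first exact: powIM_le.
  by apply: addSl => //; apply: submod_powIM.
have {}HE n : subS E (addS E' (powIM I n F')).
  by apply: NNPP => H; apply: HE; exists n.
case: (classic (exists n, subS (powIM I n F) (addS E' (powIM I n F')))) => [[n1 n1P]|HF].
  exists (n1 + c)%N; left; apply: tail => n le; rewrite XE YE.
  apply: addS_min => //; rewrite -(subnK le) powIMD => x /(powIM_mono n1P).
  rewrite powIM_addS //; last exact: submod_powIM.
  by rewrite powIMD; apply: addS_mono => //; apply: powIM_sub.
exists (0 + c)%N; right; apply: tail => n _; rewrite XE YE => H; apply: HF; exists n => x Fx.
by apply/H/addSr.
Qed.

End GoodFamilies.

(** * Associated primes of families of quotients, and prime avoidance *)

Section AssociatedPrimes.
Variables (R : comPzRingType) (T : lmodType R).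
Hypothesis noeR : noetherian_ring R.
Hypothesis fgT : finitely_generated_module T.
Implicit Types (A B C D E F K N V W Y : T -> Prop) (I J p : R -> Prop).
Implicit Types (ps : list (R -> Prop)).

Definition prime_ideal p :=
  [/\ is_ideal p, ~ p 1 & forall a b, p (a * b) -> p a \/ p b].

(* Some member of [ps] is an associated prime of the submodule of [T/K]
   generated by [m]. *)
Definition has_assoc ps K m :=
  exists r p, List.In p ps /\ forall a, K (a *: (r *: m)) <-> p a.

(** One finite list serves all selected pairs at once. Each nonzero class is only asked to have a
    multiple whose annihilator is listed; this suffices to detect zero divisors and passes to
    extensions. *)
Definition finite_assoc (C : (T -> Prop) -> T -> Prop) :=
  exists ps, (forall p, List.In p ps -> prime_ideal p) /\
             forall K m, C K m -> ~ K m -> has_assoc ps K m.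

Lemma has_assoc_sub ps qs K m : (forall p, List.In p ps -> List.In p qs) ->
  has_assoc ps K m -> has_assoc qs K m.
Proof. by move=> H [r [p [/H inp E]]]; exists r, p. Qed.

Lemma finite_assocU (C C' : (T -> Prop) -> T -> Prop) :
  finite_assoc C -> finite_assoc C' -> finite_assoc (fun K m => C K m \/ C' K m).
Proof.
move=> [ps [pps Hps]] [qs [pqs Hqs]]; exists (List.app ps qs); split.
  by move=> p; rewrite List.in_app_iff => -[/pps|/pqs].
move=> K m [CK|CK] nK.
  by apply: has_assoc_sub (Hps K m CK nK) => p; rewrite List.in_app_iff; left.
by apply: has_assoc_sub (Hqs K m CK nK) => p; rewrite List.in_app_iff; right.
Qed.

Lemma has_assocZ ps K m r : has_assoc ps K (r *: m) -> has_assoc ps K m.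
Proof.
move=> [r' [p [inp E]]]; exists (r' * r), p; split=> // a.
by rewrite -[_ *: m]scalerA.
Qed.

Lemma has_assoc_congr ps K k m : is_submodule K -> K k ->
  has_assoc ps K m -> has_assoc ps K (k + m).
Proof.
move=> sK Kk [r [p [inp E]]]; exists r, p; split=> // a; rewrite -E.
have Kark : K (a *: (r *: k)) by apply: (submodZ _ sK); apply: (submodZ _ sK).
rewrite !scalerDr; split=> H; last exact: submodD.
by rewrite -[X in K X](addKr (a *: (r *: k))); apply: submodD => //; apply: submodN.
Qed.

(* The inclusion of [Ass M] in the union of [Ass M'] and [Ass M''], for the
   extension [M = T/K] of [M'' = T/Y] by [M' = Y/K]. *)
Lemma has_assoc_ext ps K Y m : subS K Y ->
  (forall r, Y (r *: m) -> ~ K (r *: m) -> has_assoc ps K (r *: m)) ->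
  (~ Y m -> has_assoc ps Y m) -> ~ K m -> has_assoc ps K m.
Proof.
move=> KY sub quo nK.
(* Either some multiple of [m] is nonzero in [Y/K], or [R m] embeds into [T/Y] and annihilators
   modulo [K] and [Y] agree. *)
case: (classic (exists r, Y (r *: m) /\ ~ K (r *: m))) => [[r [Yr nKr]]|H].
  by apply: (@has_assocZ _ _ _ r); apply: sub.
have {}H r : Y (r *: m) -> K (r *: m).
  by move=> Yr; apply: NNPP => nKr; apply: H; exists r.
have [|r [p [inp E]]] := quo; first by move: (H 1); rewrite scale1r; tauto.
exists r, p; split=> // a; rewrite -E scalerA; split; [exact: KY|exact: H].
Qed.

(** A prime filtration in graded form. Among the stable families between $X_n\cap I^nV$ and $I^nV$
    covered by finitely many primes, take a maximal one [Y]. If it is not everything, a homogeneous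
    element with maximal annihilator modulo [Y] has a prime annihilator, and adjoining it costs only
    this one prime. *)
Lemma rees_finite_assoc I V (X : nat -> T -> Prop) :
  is_ideal I -> is_submodule V -> (forall n, is_submodule (X n)) -> stable I X ->
  finite_assoc (fun K m => exists n, K = X n /\ powIM I n V m).
Proof.
move=> iI sV sX IX.
have sI n : is_submodule (powIM I n V) by apply: submod_powIM.
pose P (Y : nat -> T -> Prop) := [/\ forall n, is_submodule (Y n), stable I Y,
  forall n, subS (interS (X n) (powIM I n V)) (Y n), forall n, subS (Y n) (powIM I n V)
  & finite_assoc (fun K m => exists n, K = X n /\ Y n m)].
pose le (Y Y' : nat -> T -> Prop) := forall n, subS (Y n) (Y' n).
have [||Y [[sY IY XY YV fY] maxY]] := @exists_maximal _ le P.
- move=> f Pf; have [l Il] := noetherian_gen noeR iI.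
  have [||||s0 s0P] := @rees_acc _ _ noeR fgT l V f.
  + exact: sV.
  + by move=> s; case: (Pf s) => [[]].
  + by move=> s; rewrite -Il; case: (Pf s) => [[]].
  + by move=> s; case: (Pf s).
  exists s0 => n x fx; apply: (s0P s0.+1 n x _ fx); rewrite -Il.
  by case: (Pf s0.+1) => [[_ _ _ H _] _]; exact: H fx.
- exists (fun n => interS (X n) (powIM I n V)); split=> //.
  + by move=> n; apply: submod_inter.
  + by apply: stable_inter => //; apply: stable_powIM.
  + by move=> n x [].
  + by move=> n x [].
  + by exists nil; split=> // K m [n [-> [Xm _]]].
suff YE n : subS (powIM I n V) (Y n).
  have [ps [pps psP]] := fY; exists ps; split=> // K m [n [-> Vm]] nX.
  by apply: psP => //; exists n; split=> //; apply: YE.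
apply: NNPP => nYE.
pose Q (u : nat * T) := powIM I u.1 V u.2 /\ ~ Y u.1 u.2.
pose leQ (u v : nat * T) := forall a, Y u.1 (a *: u.2) -> Y v.1 (a *: v.2).
have [||[n1 m] [/= [Vm nYm] maxm]] := @exists_maximal _ leQ Q.
- move=> f Qf; have [||s0 s0P] := @ideal_acc _ noeR (fun s a => Y (f s).1 (a *: (f s).2)).
  + move=> s; split.
    * by rewrite scale0r; apply: submod0.
    * by move=> a b Ya Yb; rewrite scalerDl; apply: submodD.
    * by move=> a b Yb; rewrite -scalerA; apply: submodZ.
  + by move=> s a; case: (Qf s) => _; apply.
  by exists s0 => a; apply: s0P.
- apply: NNPP => H; apply: nYE => x Vx; apply: NNPP => nYx.
  by apply: H; exists (n, x).
pose p a := Y n1 (a *: m).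
have pp : prime_ideal p.
  split; [split|by rewrite /p scale1r|].
  - by rewrite /p scale0r; apply: submod0.
  - by move=> a b Ya Yb; rewrite /p scalerDl; apply: submodD.
  - by move=> a b Yb; rewrite /p -scalerA; apply: submodZ.
  move=> a b pab; apply: NNPP => H.
  have nb : ~ p b by tauto.
  apply: H; left; apply: (maxm (n1, b *: m)); rewrite /=.
  - by split=> //=; apply: submodZ.
  - by move=> c /= Yc; rewrite scalerA mulrC -scalerA; apply: submodZ.
  - by rewrite scalerA.
pose L i := powIM I (i - n1) (gen [:: m]).
have sL i : is_submodule (L i) by apply/submod_powIM/submod_gen.
have genm x : gen [:: m] x -> exists r, x = r *: m.
  by move=> [r [b [-> ->]]]; exists r; rewrite addr0.
have LV i : (n1 <= i)%N -> subS (L i) (powIM I i V).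
  move=> le1; rewrite -[X in powIM I X V](subnK le1) powIMD; apply: powIM_mono.
  by move=> x /genm[r ->]; apply: submodZ.
(* Below [n1] truncated subtraction would make [L i] the span of [m], hence the case distinction. *)
pose Y' i := if (n1 <= i)%N then addS (Y i) (L i) else Y i.
have YY' : le Y Y'.
  by move=> i x Yx; rewrite /Y'; case: ifP => // _; apply: addSl.
suff PY' : P Y'.
  apply: nYm; apply: (maxY Y') => //; rewrite /Y' leqnn; apply: addSr => //.
  by rewrite /L subnn; apply: gen_consl.
split.
- by move=> i; rewrite /Y'; case: ifP => // _; apply: submod_add.
- move=> i a x Ia; rewrite /Y'; case: ifP => le1; last first.
    by move=> Yx; case: ifP => _; [apply: addSl => //|]; apply: IY.
  move=> [y [l [Yy Ll ->]]]; rewrite (leqW le1) scalerDr; apply: addS_intro.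
    exact: IY.
  by rewrite /L subSn //; apply: prodIM_mem.
- by move=> i x /XY; apply: YY'.
- move=> i; rewrite /Y'; case: ifP => le1; last exact: YV.
  by apply: addS_min => //; apply: LV.
have [ps [pps psP]] := fY; exists (cons p ps); split.
  by move=> q [<-|/pps].
have psY i y : Y i y -> ~ X i y -> has_assoc (p :: ps) (X i) y.
  move=> Yy nXy; apply: (@has_assoc_sub ps) => [q|]; first by right.
  by apply: psP => //; exists i.
move=> K x [i [-> {K}]]; rewrite /Y'; case: ifP => le1; last exact: psY.
move=> [w [l [Yw Ll ->]]].
apply: (has_assoc_ext (Y := addS (X i) (Y i))); first exact: addSl.
  move=> r [k [y [Xk Yy E]]]; rewrite E => nX; apply: has_assoc_congr => //.
  by apply: psY => // Xy; apply: nX; apply: submodD.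
have Vl : powIM I i V l by apply: LV.
(* Since $X_i\cap I^iV\subseteq Y_i$, the annihilator of [w + l] modulo [X i + Y i] is that of [l]
   modulo [Y i]. It contains [p], which kills [m] modulo [Y n1], and equals [p] by maximality. *)
have XYl a : addS (X i) (Y i) (a *: (w + l)) <-> Y i (a *: l).
  rewrite scalerDr; split=> [[k [y [Xk Yy E]]]|Yl]; last first.
    by apply: addSr => //; apply: submodD => //; apply: submodZ.
  have {}E : a *: l = k + (y - a *: w).
    by rewrite addrA -E addrC addKr.
  have Yy' : Y i (y - a *: w) by apply: submodB => //; apply: submodZ.
  rewrite E; apply: submodD => //; apply: XY; split=> //.
  rewrite -(addrK (y - a *: w) k) -E; apply: submodB => //; first exact: submodZ.
  exact: YV.
move=> nXY; exists 1, p; split; first by left.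
move=> a; rewrite scale1r XYl.
have nYl : ~ Y i l by move=> Yl; apply: nXY; rewrite -[_ + l]scale1r XYl scale1r.
have pl b : p b -> Y i (b *: l).
  move=> pb; have : scal b (L i) (b *: l) by exists l.
  rewrite /L -powIM_scal; last exact: submod_gen.
  have bY : subS (scal b (gen [:: m])) (Y n1).
    by move=> _ [_ /genm[r ->] ->]; rewrite scalerA mulrC -scalerA; apply: submodZ.
  move/(powIM_mono bY)/(stable_powIM_shift sY IY).
  by rewrite subnK.
by split=> [Yl|/pl//]; apply: (maxm (i, l)).
Qed.

Lemma module_finite_assoc K : is_submodule K ->
  finite_assoc (fun L _ => L = K).
Proof.
move=> sK; have [||||ps [pps psP]] := @rees_finite_assoc (fun r => r = 0) (fun=> True) (fun=> K).
- exact: (@submod_zero _ R^o).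
- exact: submod_full.
- by [].
- by move=> n a x _; apply: submodZ.
by exists ps; split=> // L m -> nK; apply: psP => //; exists 0%N.
Qed.

(** With $Y_n=E'+I^n(F+F')$, the module $T/K_{n+c}$ maps onto $T/Y_n$, and so on down to $T/Y_0$.
    The kernels are images of $I^nF$ and of $I^i(F+F')$, so [rees_finite_assoc] bounds their primes
    independently of $n$; $T/Y_0$ is a single module. *)
Lemma good_finite_assoc I (N K : nat -> T -> Prop) : is_ideal I ->
  good I N -> good I K ->
  exists n0, finite_assoc (fun L m => exists n, [/\ (n0 <= n)%N, L = K n & N n m]).
Proof.
move=> iI gN gK; have [c [E [F [E' [F' [sE sF sE' sF' [NE KE]]]]]]] := good_common gN gK.
exists c.
have sp n V : is_submodule V -> is_submodule (powIM I n V) by exact: submod_powIM.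
pose G := addS F F'; have sG : is_submodule G by apply: submod_add.
pose Y n := addS E' (powIM I n G).
have sY n : is_submodule (Y n) by apply: submod_add => //; apply: sp.
have sK n : is_submodule (K (n + c)%N) by rewrite KE; apply: submod_add => //; apply: sp.
have st A : is_submodule A -> stable I (fun n => addS E' (powIM I n A)).
  move=> sA n a _ Ia [u [v [Eu Av ->]]]; rewrite scalerDr; apply: addS_intro.
    exact: submodZ.
  exact: prodIM_mem.
have IK : stable I (fun n => K (n + c)%N).
  by move=> n a x; rewrite !KE; apply: st.
have IY : stable I (fun n => Y n.+1) by move=> n; apply: st.
have f1 := rees_finite_assoc iI sF sK IK.
have f2 := rees_finite_assoc iI sG (fun n => sY n.+1) IY.
have [ps [pps psP]] := finite_assocU (finite_assocU f1 f2) (module_finite_assoc (sY 0%N)).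
exists ps; split=> // _ m [n' [le -> Nm]] nKm.
move: Nm nKm; rewrite -(subnK le); move: {n' le}(n' - c)%N => n.
rewrite NE => -[e [f [Ee Ff Em]]] nKm.
have YE : Y n = addS (K (n + c)%N) (powIM I n F).
  by rewrite KE /Y /G powIM_addS // [addS (powIM I n F) _]addSC addSA.
have KY : subS (K (n + c)%N) (Y n) by rewrite YE; apply: addSl; apply: sp.
apply: (has_assoc_ext KY) => //.
  move=> r; rewrite {1}YE => -[k [g [Kk Fg ->]]] nK; apply: has_assoc_congr => //.
  apply: psP; first by left; left; exists n.
  by move=> Kg; apply: nK; apply: submodD.
elim: n {e f Ee Ff Em nKm YE KY} m => [|n IHn] m nY; first by apply: psP => //; right.
apply: (has_assoc_ext (Y := Y n)) => //.
- by apply: addS_mono => //; apply: prodIM_sub; apply: sp.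
- move=> r [k [g [Ek Gg ->]]] nK.
  have Yk : Y n.+1 k by apply: addSl => //; apply: sp.
  apply: has_assoc_congr => //; apply: psP; first by left; right; exists n.
  by move=> Yg; apply: nK; apply: submodD.
- exact: IHn.
Qed.

(** Induction on the number of primes. A prime inside [p] is dropped from the list. Otherwise, if
    the element [z] found for the others lies in [p], it is corrected by some [w] in [J] and in all
    the others but not in [p]. *)
Lemma prime_avoidance ps J : is_ideal J ->
  (forall p, List.In p ps -> prime_ideal p /\ ~ subS J p) ->
  exists z, J z /\ forall p, List.In p ps -> ~ p z.
Proof.
move=> iJ; have [n] := ubnP (size ps); elim: n ps => // n IH [|p ps] /= sz Hps.
  by exists 0; split=> //; apply: ideal0.
have [[ip np1 pP] nJp] := Hps p (or_introl erefl).
case: (classic (exists q, List.In q ps /\ subS q p)) => [[q [inq qp]]|Hq].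
  have [l1 [l2 E]] := List.in_split _ _ inq.
  have [|r|z [Jz zP]] := IH (p :: List.app l1 l2).
  - by move: sz; rewrite E /= -![size _]/(length _) !List.length_app /= !plusE addnS.
  - move=> [<-|/List.in_app_iff H]; first exact: Hps (or_introl erefl).
    by apply: Hps; right; rewrite E; apply/List.in_app_iff; case: H => H; [left|right; right].
  exists z; split=> // r [<-|]; first by apply: zP; left.
  rewrite E => /List.in_app_iff[H|[<-|H]].
  - by apply: zP; right; apply/List.in_app_iff; left.
  - by move=> /qp; apply: zP; left.
  - by apply: zP; right; apply/List.in_app_iff; right.
have [z [Jz zP]] : exists z, J z /\ forall p, List.In p ps -> ~ p z.
  by apply: IH => // q inq; apply: Hps; right.
case: (classic (p z)) => [pz|npz]; last first.
  by exists z; split=> // q [<-|/zP].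
have [w [Jw npw wP]] : exists w, [/\ J w, ~ p w & forall q, List.In q ps -> q w].
  have {IH sz zP} : forall q, List.In q ps -> prime_ideal q /\ ~ subS q p.
    move=> q inq; split; first by case: (Hps q (or_intror inq)).
    by move=> qp; apply: Hq; exists q.
  (* [w] is the product of an element of [J] and one of each [q], all outside the prime [p]. *)
  elim: (ps) => [|q l IHl] Hl.
    apply: NNPP => H; apply: nJp => x Jx; apply: NNPP => npx; apply: H.
    by exists x.
  have [w [Jw npw wP]] : exists w, [/\ J w, ~ p w & forall q, List.In q l -> q w].
    by apply: IHl => r inr; apply: Hl; right.
  have [[iq _ _] nqp] := Hl q (or_introl erefl).
  have [v [qv npv]] : exists v, q v /\ ~ p v.
    apply: NNPP => H; apply: nqp => x qx; apply: NNPP => npx; apply: H.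
    by exists x.
  exists (v * w); split; first exact: idealM.
    by move=> /pP[].
  move=> r [<-|inr]; first by rewrite mulrC; apply: idealM.
  by apply: idealM; [case: (Hl r (or_intror inr)) => -[]|apply: wP].
exists (z + w); split; first exact: idealD.
move=> q [<-|inq] qzw.
  by apply: npw; rewrite -(addKr z w); apply: idealD => //; apply: idealN.
have [[iq _ _] _] := Hps q (or_intror inq).
apply: (zP q inq); rewrite -(addrK w z); apply: idealD => //; apply: idealN => //.
exact: wP.
Qed.

Definition nzd N K z := forall m, N m -> K (z *: m) -> K m.
Definition socle J N K m := N m /\ forall j, J j -> K (j *: m).

(** If [J] kills no nonzero class, it lies in no prime that occurs as an annihilator, so
    [prime_avoidance] gives [z] outside all of these. If $zm=0$ with $m\ne0$, then [z] would lie in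
    the prime annihilator of a multiple of [m]. *)
Lemma common_nzd (C : (T -> Prop) -> (T -> Prop) -> Prop) J : is_ideal J ->
  (forall N K, C N K -> is_submodule N /\ is_submodule K) ->
  finite_assoc (fun K m => exists2 N, C N K & N m) ->
  (forall N K, C N K -> subS (socle J N K) K) ->
  exists z, J z /\ forall N K, C N K -> nzd N K z.
Proof.
move=> iJ sNK [ps [pps psP]] soc0.
pose occurs p := exists N K m,
  [/\ C N K, N m, ~ K m & forall a, K (a *: m) <-> p a].
(* Only the primes that occur are kept: [J] may be contained in other members of [ps]. *)
have [qs qsP] : exists qs, forall p, List.In p qs <-> List.In p ps /\ occurs p.
  elim: ps {pps psP} => [|p ps [qs IH]]; first by exists nil => p /=; tauto.
  case: (classic (occurs p)) => Hp; last first.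
    by exists qs => q; rewrite IH /=; split=> [[]|[[<-|]]]; tauto.
  by exists (cons p qs) => q; rewrite /= IH; split=> [[<-|[]]|[[<-|]]]; tauto.
have [|z [Jz zP]] := @prime_avoidance qs J iJ.
  move=> p /qsP[/pps pp [N [K [m [CNK Nm nKm Kp]]]]]; split=> // Jp.
  apply: nKm; apply: (soc0 N K CNK); split=> // j /Jp.
  by rewrite Kp.
exists z; split=> // N K CNK m Nm Kzm; apply: NNPP => nKm.
have [|r [p [inp Kp]]] := psP K m _ nKm; first by exists N.
apply: (zP p); last by rewrite -Kp scalerA mulrC -scalerA; apply: submodZ Kzm; case: (sNK N K CNK).
apply/qsP; split=> //; exists N, K, (r *: m); split=> //.
  by apply: submodZ => //; case: (sNK N K CNK).
move=> Krm; case: (pps p inp) => _ np1 _; apply: np1.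
by rewrite -Kp scale1r.
Qed.

End AssociatedPrimes.

(** * Regular sequences, Rees's theorem on their maximal lengths, and depth *)

Section Depth.
Variables (R : comPzRingType) (T : lmodType R).
Hypothesis noeR : noetherian_ring R.
Hypothesis fgT : finitely_generated_module T.
Variable J : R -> Prop.
Hypothesis iJ : is_ideal J.
Implicit Types (K N : T -> Prop) (xs ys zs : seq R).

Definition quo N K z := addS K (scal z N).
Definition quos N K xs := foldl (quo N) K xs.

(** Regularity one element at a time, for inductions on the sequence. Nonvanishing of the last
    quotient is left out; by [regular_seqP] it is automatic when $JM\ne M$ for $M=N/K$. *)
Fixpoint regs N K xs : Prop :=
  if xs is x :: xs' then [/\ J x, nzd N K x & regs N (quo N K x) xs'] else True.

Lemma submod_quo N K z : is_submodule N -> is_submodule K -> is_submodule (quo N K z).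
Proof. by move=> sN sK; apply: submod_add => //; apply: submod_scal. Qed.

Lemma submod_quos N K xs : is_submodule N -> is_submodule K -> is_submodule (quos N K xs).
Proof. by move=> sN; elim: xs K => //= x xs IH K sK; apply/IH/submod_quo. Qed.

Lemma quoC N K x y : quo N (quo N K x) y = quo N (quo N K y) x.
Proof. by rewrite /quo -!addSA (addSC (scal x N)). Qed.

Lemma quos_rcons N K xs x : quos N K (rcons xs x) = quo N (quos N K xs) x.
Proof. by rewrite /quos foldl_rcons. Qed.

Lemma quos_quo N K z xs : quos N (quo N K z) xs = quo N (quos N K xs) z.
Proof. by elim: xs K => //= x xs IH K; rewrite quoC IH. Qed.

Lemma regs_rcons N K xs x :
  regs N K (rcons xs x) <-> [/\ regs N K xs, J x & nzd N (quos N K xs) x].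
Proof.
elim: xs K => [|y xs IH] K /=; first by split=> [[]|[]].
by split=> [[Jy ny /IH[]]|[[Jy ny ry] Jx nx]] //; split=> //; apply/IH.
Qed.

Lemma socle0_nzd N K z : is_submodule K -> J z -> nzd N K z -> subS (socle J N K) K.
Proof. by move=> sK Jz nz m [Nm Jm]; apply: nz => //; apply: Jm. Qed.

(* [m] modulo [xM] is sent to [m'] modulo [yM] where [y m = x m'];
   this is [Hom(R/J, M/xM) = Ext^1(R/J, M) = Hom(R/J, M/yM)]. *)
Lemma socle_exchange N K x y : is_submodule N -> is_submodule K -> subS K N ->
  J x -> J y -> nzd N K x -> nzd N K y ->
  subS (socle J N (quo N K y)) (quo N K y) ->
  subS (socle J N (quo N K x)) (quo N K x).
Proof.
move=> sN sK KN Jx Jy nx ny soc0 m [Nm Jm].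
have [k [_ [Kk [m' Nm' ->] Eym]]] := Jm y Jy.
have : quo N K y m'.
  apply: soc0; split=> // j /Jm[k1 [_ [Kk1 [m1 Nm1 ->] Ejm]]].
  have H : K (j *: m' - y *: m1).
    apply: nx; first by apply: submodB => //; apply: submodZ.
    have -> : x *: (j *: m' - y *: m1) = y *: k1 - j *: k.
      have H : j *: k + (j * x) *: m' = y *: k1 + (y * x) *: m1.
        by rewrite -!scalerA -!scalerDr -Eym -Ejm !scalerA mulrC.
      rewrite scalerBr !scalerA [x * j]mulrC [x * y]mulrC.
      by rewrite -[(j * x) *: m'](addKr (j *: k)) H addrA addrK addrC.
    by apply: submodB => //; apply: submodZ.
  exists (j *: m' - y *: m1), (y *: m1); rewrite subrK; split=> //.
  by exists m1.
move=> [k2 [_ [Kk2 [m2 Nm2 ->] Em']]].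
have H : K (m - x *: m2).
  apply: ny; first by apply: submodB => //; apply: submodZ.
  rewrite scalerBr Eym Em' scalerDr !scalerA [x * y]mulrC addrA addrK.
  by apply: submodD => //; apply: submodZ.
by exists (m - x *: m2), (x *: m2); rewrite subrK; split=> //; exists m2.
Qed.

(** If $xm=zm'$ modulo [K], then $m'=xm_2$ modulo [K] because [z] is regular modulo [x]; cancelling
    [x] gives $m=zm_2$ modulo [K]. *)
Lemma nzd_quo_swap N K x z : is_submodule N -> is_submodule K -> subS K N ->
  nzd N K x -> nzd N (quo N K x) z -> nzd N (quo N K z) x.
Proof.
move=> sN sK KN nx nz m Nm [k [_ [Kk [m' Nm' ->] E]]].
have [|k' [_ [Kk' [m2 Nm2 ->] E']]] := nz m' Nm'.
  exists (- k), (x *: m); split; first exact: submodN.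
    by exists m.
  by rewrite E addKr.
have H : K (m - z *: m2).
  apply: nx; first by apply: submodB => //; apply: submodZ.
  rewrite scalerBr E E' scalerDr !scalerA [x * z]mulrC addrA addrK.
  by apply: submodD => //; apply: submodZ.
by exists (m - z *: m2), (z *: m2); rewrite subrK; split=> //; exists m2.
Qed.

Fixpoint prefixes N K xs : list (T -> Prop) :=
  cons K (if xs is x :: xs' then prefixes N (quo N K x) xs' else nil).

Lemma prefixes_head N K xs : List.In K (prefixes N K xs).
Proof. by case: xs => [|x xs]; left. Qed.

Lemma quo_sub N K z : is_submodule N -> subS K N -> subS (quo N K z) N.
Proof. by move=> sN KN; apply: addS_min => // _ [m Nm ->]; apply: submodZ. Qed.

Lemma quos_sub N K xs : is_submodule N -> subS K N -> subS (quos N K xs) N.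
Proof. by move=> sN; elim: xs K => //= x xs IH K KN; apply: IH; apply: quo_sub. Qed.

Lemma prefixes_last N K xs : List.In (quos N K xs) (prefixes N K xs).
Proof. by elim: xs K => [|x xs IH] K; [left|right; apply: IH]. Qed.

Lemma submod_prefixes N K xs L : is_submodule N -> is_submodule K ->
  List.In L (prefixes N K xs) -> is_submodule L.
Proof.
move=> sN; elim: xs K => [|x xs IH] K sK /=; first by move=> [<-|].
by move=> [<- //|]; apply/IH/submod_quo.
Qed.

Lemma regs_socle0 N K xs x L : is_submodule N -> is_submodule K ->
  regs N K (rcons xs x) -> List.In L (prefixes N K xs) -> subS (socle J N L) L.
Proof.
move=> sN; elim: xs K => [|y xs IH] K sK /= [Jx nx r] [<-|] //.
- exact: socle0_nzd nx.
- exact: socle0_nzd nx.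
- exact/IH/r/submod_quo.
Qed.

Lemma regs_quo N K z xs : is_submodule N -> is_submodule K -> subS K N ->
  regs N K xs -> (forall L, List.In L (prefixes N K xs) -> nzd N L z) ->
  regs N (quo N K z) xs.
Proof.
move=> sN; elim: xs K => //= x xs IH K sK KN [Jx nx r] H.
split=> //.
  by apply: nzd_quo_swap => //; apply: H; right; apply: prefixes_head.
rewrite quoC; apply: IH => //; [exact: submod_quo|exact: quo_sub|].
by move=> L inL; apply: H; right.
Qed.

Lemma finite_assoc_list (Ks : list (T -> Prop)) :
  (forall K, List.In K Ks -> is_submodule K) ->
  finite_assoc (fun K (_ : T) => List.In K Ks).
Proof.
elim: Ks => [|K Ks IH] sKs; first by exists nil; split.
have [ps [pps psP]] : finite_assoc (fun L (_ : T) => L = K \/ List.In L Ks).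
  apply: finite_assocU; first by apply: module_finite_assoc => //; apply: sKs; left.
  by apply: IH => L inL; apply: sKs; right.
by exists ps; split=> // L m /= [<-|inL] nL; apply: psP => //; [left|right].
Qed.

Lemma common_nzd_list N (Ks : list (T -> Prop)) : is_submodule N ->
  (forall K, List.In K Ks -> is_submodule K) ->
  (forall K, List.In K Ks -> subS (socle J N K) K) ->
  exists z, J z /\ forall K, List.In K Ks -> nzd N K z.
Proof.
move=> sN sKs soc0.
have [|||z [Jz zP]] := @common_nzd _ T (fun N' K => N' = N /\ List.In K Ks) J iJ.
- by move=> N' K [-> /sKs].
- have [ps [pps psP]] := finite_assoc_list sKs.
  by exists ps; split=> // K m [N' [_ inK] _]; apply: psP.
- by move=> N' K [->]; apply: soc0.
by exists z; split=> // K inK; apply: zP.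
Qed.

(** Rees's theorem: whether [J] kills a nonzero element of the last quotient depends only on the
    length of the regular sequence. Prime avoidance gives one [z] in [J] regular after all proper
    initial segments of both sequences. By [socle_exchange] it replaces both last elements; moved to
    the front, it leaves shorter sequences to compare modulo $K+zN$. *)
Lemma rees_socle N K xs ys : is_submodule N -> is_submodule K -> subS K N ->
  regs N K xs -> regs N K ys -> size xs = size ys ->
  subS (socle J N (quos N K ys)) (quos N K ys) ->
  subS (socle J N (quos N K xs)) (quos N K xs).
Proof.
move=> sN; elim/last_ind: xs ys K => [|xs x IH] ys K sK KN.
  by case: ys.
case/lastP: ys => [|ys y] rx ry; rewrite ?size_rcons // => -[sz].
have [||z [Jz zP]] := @common_nzd_list N
  (List.app (prefixes N K xs) (prefixes N K ys)) sN.
- by move=> L /List.in_app_iff[]; apply: submod_prefixes.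
- by move=> L /List.in_app_iff[]; [apply: regs_socle0 rx|apply: regs_socle0 ry].
have zxs L : List.In L (prefixes N K xs) -> nzd N L z.
  by move=> inL; apply: zP; apply/List.in_app_iff; left.
have zys L : List.In L (prefixes N K ys) -> nzd N L z.
  by move=> inL; apply: zP; apply/List.in_app_iff; right.
move/regs_rcons: rx => [rx Jx nx]; move/regs_rcons: ry => [ry Jy ny].
rewrite !quos_rcons => soc0.
apply: (@socle_exchange _ _ x z) => //; try exact: submod_quos; try exact: quos_sub.
  by apply: zxs; apply: prefixes_last.
rewrite -quos_quo; apply: (IH ys) => //; try exact: regs_quo.
- exact: submod_quo.
- exact: quo_sub.
rewrite quos_quo.
apply: (@socle_exchange _ _ z y) => //; try exact: submod_quos; try exact: quos_sub.
by apply: zys; apply: prefixes_last.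
Qed.

Lemma seqIM_nil N : seqIM [::] N = fun x => x = 0.
Proof.
apply: predext => x; first by move=> [m [_ ->]]; rewrite big_ord0.
by move=> ->; exists (fun=> 0); split; [case|rewrite big_ord0].
Qed.

Lemma seqIM_cons x xs N : seqIM (x :: xs) N = addS (scal x N) (seqIM xs N).
Proof.
apply: predext => y.
  move=> [m [Nm ->]]; rewrite big_ord_recl /=; apply: addS_intro; first by exists (m ord0).
  by exists (fun i => m (lift ord0 i)).
move=> [_ [_ [[m Nm ->] [m' [Nm' ->] ->]]]].
exists (fun i => if unlift ord0 i is Some j then m' j else m); split.
  by move=> i; case: (unlift ord0 i).
rewrite big_ord_recl /= unlift_none; congr (_ + _).
by apply: eq_bigr => i _; rewrite liftK.
Qed.

Lemma quosE N K xs : addS K (seqIM xs N) = quos N K xs.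
Proof.
elim: xs K => [|x xs IH] K; first by rewrite seqIM_nil addS0.
by rewrite seqIM_cons addSA IH.
Qed.

Lemma regsP N K xs : regs N K xs <->
  (forall i, (i < size xs)%N -> J xs`_i) /\
  (forall i, (i < size xs)%N -> nzd N (addS K (seqIM (take i xs) N)) xs`_i).
Proof.
elim: xs K => [|x xs IH] K /=; first by split.
split=> [[Jx nx /IH[Jxs nxs]]|[Jxs nxs]].
  split=> -[|i] //= si; [exact: Jxs|by rewrite quosE|].
  by rewrite seqIM_cons addSA; apply: nxs.
split; [exact: (Jxs 0%N)|by have := nxs 0%N isT; rewrite quosE|].
apply/IH; split=> i si; first exact: (Jxs i.+1).
by have := nxs i.+1 si; rewrite /= seqIM_cons addSA.
Qed.

Lemma quos_sub_prodIM N K xs : is_submodule N -> is_submodule K ->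
  (forall i, (i < size xs)%N -> J xs`_i) ->
  subS (quos N K xs) (addS K (prodIM J N)).
Proof.
move=> sN sK Jxs; rewrite -quosE; apply: addS_mono => // _ [m [Nm ->]].
apply: submod_sum; first exact: submod_prodIM.
by move=> i; apply: prodIM_mem => //; apply: Jxs.
Qed.

Lemma regular_seqP N K xs : is_submodule N -> is_submodule K ->
  ~ subS N (addS K (prodIM J N)) -> (regular_seq J N K xs <-> regs N K xs).
Proof.
move=> sN sK JN; rewrite regsP; split=> [[]|[Jxs nxs]] //.
split=> // H; apply: JN => m /H; rewrite quosE; exact: quos_sub_prodIM.
Qed.

(** A sequence can be prolonged exactly when [J] kills no nonzero element of the last quotient: one
    direction is [socle0_nzd], the other prime avoidance. *)
Lemma maximal_regular_seqP N K xs : is_submodule N -> is_submodule K ->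
  ~ subS N (addS K (prodIM J N)) ->
  (maximal_regular_seq J N K xs <->
   regs N K xs /\ ~ subS (socle J N (quos N K xs)) (quos N K xs)).
Proof.
move=> sN sK JN; rewrite /maximal_regular_seq.
split=> [[/(regular_seqP _ sN sK JN) rx maxx]|[rx soc]]; split=> //; last 2 first.
- exact/regular_seqP.
- move=> [y /(regular_seqP _ sN sK JN)/regs_rcons[_ Jy ny]]; apply: soc.
  by apply: socle0_nzd ny => //; apply: submod_quos.
move=> soc0; apply: maxx.
have [||z [Jz zP]] := @common_nzd_list N (cons (quos N K xs) nil) sN.
- by move=> L [<-|] //; apply: submod_quos.
- by move=> L [<-|].
exists z; apply/regular_seqP => //; apply/regs_rcons; split=> //.
by apply: zP; left.
Qed.

Lemma regs_take N K xs k : regs N K xs -> regs N K (take k xs).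
Proof.
elim: xs K k => [|x xs IH] K [|k] //= [Jx nx r]; split=> //; exact: IH.
Qed.

Lemma maximal_regular_seq_size N K xs ys : is_submodule N -> is_submodule K ->
  subS K N -> ~ subS N (addS K (prodIM J N)) ->
  maximal_regular_seq J N K xs -> maximal_regular_seq J N K ys -> size xs = size ys.
Proof.
move=> sN sK KN JN.
suff half xs' ys' : maximal_regular_seq J N K xs' -> maximal_regular_seq J N K ys' ->
    ~ (size xs' < size ys')%N.
  move=> mx my; have := half _ _ mx my; have := half _ _ my mx.
  by case: ltngtP => //; tauto.
move=> /(maximal_regular_seqP _ sN sK JN)[rx socx].
move=> /(maximal_regular_seqP _ sN sK JN)[ry _] lt; apply: socx.
(* One element more than in [xs] is kept: it shows that the socle vanishes after [size xs] elements
   of [ys], hence after [xs] by [rees_socle]. *)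
have ry' := regs_take (size xs').+1 ry; rewrite (take_nth 0 lt) in ry'.
have [ryt Jy ny] := (regs_rcons _ _ _ _).1 ry'.
apply: (rees_socle sN sK KN rx ryt); first by rewrite size_take lt.
by apply: socle0_nzd ny => //; apply: submod_quos.
Qed.

Lemma depth_is_size N K xs : is_submodule N -> is_submodule K -> subS K N ->
  ~ subS N (addS K (prodIM J N)) -> maximal_regular_seq J N K xs ->
  depth_is J N K (Some (size xs)).
Proof.
move=> sN sK KN JN mx; split=> //; split; first by exists xs.
by move=> ys my; apply: maximal_regular_seq_size my mx.
Qed.

End Depth.

(** * Good families of quotients for large $n$ *)

Section Asymptotics.
Variables (R : comPzRingType) (T : lmodType R).
Hypothesis noeR : noetherian_ring R.
Hypothesis fgT : finitely_generated_module T.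
Variables (I J : R -> Prop).
Hypotheses (iI : is_ideal I) (iJ : is_ideal J).
Variables (N K : nat -> T -> Prop).
Hypotheses (sN : forall n, is_submodule (N n)) (sK : forall n, is_submodule (K n)).
Hypotheses (KN : forall n, subS (K n) (N n)).
Hypotheses (gN : good I N) (gK : good I K).

Definition eventually (P : nat -> Prop) := exists n0, forall n, (n0 <= n)%N -> P n.

Lemma eventually_and (P Q : nat -> Prop) :
  eventually P -> eventually Q -> eventually (fun n => P n /\ Q n).
Proof.
move=> [n1 H1] [n2 H2]; exists (maxn n1 n2) => n; rewrite geq_max => /andP[le1 le2].
by split; [apply: H1|apply: H2].
Qed.

Lemma eventually_mono (P Q : nat -> Prop) :
  (forall n, P n -> Q n) -> eventually P -> eventually Q.
Proof. by move=> PQ [n0 H]; exists n0 => n /H/PQ. Qed.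

Lemma good_quos (L : nat -> T -> Prop) zs :
  good I L -> good I (fun n => quos (N n) (L n) zs).
Proof.
elim: zs L => [|z zs IH] L gL //=; apply: (IH (fun n => quo (N n) (L n) z)).
by apply: good_add => //; apply: good_scal.
Qed.

(** [J] is finitely generated, so the socle is the intersection of [N n] with finitely many colons
    of [L n] by generators. *)
Lemma good_socle (L : nat -> T -> Prop) : (forall n, is_submodule (L n)) ->
  good I L -> good I (fun n => socle J (N n) (L n)).
Proof.
move=> sL gL; have [l ->] := noetherian_gen noeR iJ.
elim: l => [|a l IH].
  have -> : (fun n => socle (gen (T := R^o) [::]) (N n) (L n)) = N.
    apply: functional_extensionality => n; apply: predext => [m []|m Nm] //.
    by split=> // j ->; rewrite scale0r; apply: submod0 (sL n).
  exact: gN.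
have -> : (fun n => socle (gen (a :: l)) (N n) (L n)) =
    (fun n => interS (socle (gen l) (N n) (L n)) (fun x => L n (a *: x))).
  apply: functional_extensionality => n; apply: predext => m.
    move=> [Nm Hm]; split; last by apply: Hm; apply: gen_consl.
    by split=> // j gj; apply: Hm; apply: gen_consr.
  move=> [[Nm Hm] La]; split=> // _ [r [b [gb ->]]].
  by rewrite scalerDl -scalerA; apply: (submodD (sL n)); [apply: submodZ (sL n) La|apply: Hm].
by apply: good_inter => //; apply: good_colon.
Qed.

(** [good_finite_assoc] treats all large [n] together, so a single [z] works for all of them. *)
Lemma regs_extend zs :
  eventually (fun n => regs J (N n) (K n) zs) ->
  eventually (fun n => subS (socle J (N n) (quos (N n) (K n) zs)) (quos (N n) (K n) zs)) ->
  exists z, eventually (fun n => regs J (N n) (K n) (rcons zs z)).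
Proof.
move=> [n1 H1] [n2 H2]; pose L n := quos (N n) (K n) zs.
have sL n : is_submodule (L n) by apply: submod_quos.
have [n3 fa] := good_finite_assoc noeR fgT iI gN (good_quos zs gK).
pose n0 := maxn n1 (maxn n2 n3).
have [|||z [Jz zP]] := @common_nzd _ T
  (fun N' K' => exists n, [/\ (n0 <= n)%N, N' = N n & K' = L n]) J iJ.
- by move=> N' K' [n [_ -> ->]].
- have [ps [pps psP]] := fa; exists ps; split=> // K' m [N' [n [le -> ->]] Nm].
  apply: psP; exists n; split=> //; apply: leq_trans le.
  by rewrite !leq_max leqnn !orbT.
- move=> N' K' [n [le -> ->]]; apply: H2; apply: leq_trans le.
  by rewrite !leq_max leqnn !orbT.
exists z, n0 => n le; apply/regs_rcons; split=> //; last by apply: zP; exists n.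
by apply: H1; apply: leq_trans le; rewrite leq_maxl.
Qed.

(* These ideals grow strictly with [zs], which bounds the length of a common
   regular sequence. *)
Let ann zs (r : R) := J r /\ eventually (fun n =>
  forall m, N n m -> quos (N n) (K n) zs (r *: m)).

Lemma ideal_ann zs : is_ideal (ann zs).
Proof.
have sL n : is_submodule (quos (N n) (K n) zs) by apply: submod_quos.
split.
- split; first exact: ideal0.
  by exists 0%N => n _ m _; rewrite scale0r; apply: submod0.
- move=> a b [Ja Ha] [Jb Hb]; split; first exact: idealD.
  apply: eventually_mono (eventually_and Ha Hb) => n [{}Ha {}Hb] m Nm.
  by rewrite scalerDl; apply: submodD; auto.
- move=> a b [Jb Hb]; split; first exact: idealM.
  apply: eventually_mono Hb => n Hb m Nm.
  by rewrite -scalerA; apply: submodZ; auto.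
Qed.

(** Take [zs] with [ann zs] maximal. If the socle eventually vanished, [zs] could be prolonged by
    some [z], and maximality would put [z] in [ann zs]. For large [n], [z] would be both zero and a
    nonzerodivisor on the quotient, forcing $N_n\subseteq K_n+JN_n$. *)
Lemma common_maximal_regs :
  eventually (fun n => ~ subS (N n) (addS (K n) (prodIM J (N n)))) ->
  exists zs, eventually (fun n => regs J (N n) (K n) zs /\
    ~ subS (socle J (N n) (quos (N n) (K n) zs)) (quos (N n) (K n) zs)).
Proof.
move=> JN.
pose P zs := eventually (fun n => regs J (N n) (K n) zs).
have [||zs [Pzs maxzs]] := @exists_maximal _ (fun zs zs' => subS (ann zs) (ann zs')) P.
- move=> f Pf; have [||s0 s0P] := @ideal_acc _ noeR (fun s => ann (f s)).
  + by move=> s; apply: ideal_ann.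
  + by move=> s; case: (Pf s).
  by exists s0; apply: s0P.
- by exists [::], 0%N.
exists zs.
have sL n : is_submodule (quos (N n) (K n) zs) by apply: submod_quos.
have [n0 [soc0|soc]] := good_subS (good_socle sL (good_quos zs gK)) (good_quos zs gK).
  2: by apply: eventually_and => //; exists n0.
have [|z Pz] := regs_extend Pzs; first by exists n0.
have : ann zs z.
  apply: (maxzs _ Pz).
    move=> r [Jr Hr]; split=> //; apply: eventually_mono Hr => n Hr m Nm.
    rewrite quos_rcons; apply: addSl; first exact: submod_scal.
    exact: Hr.
  have [n1 H1] := Pz; split; first by case/regs_rcons: (H1 n1 (leqnn _)).
  exists 0%N => n _ m Nm; rewrite quos_rcons; apply: addSr => //.
  by exists m.
move=> [_ zL]; have [n H] := eventually_and JN (eventually_and zL Pz).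
have [{}JN [{}zL /regs_rcons[rz Jz nz]]] := H n (leqnn _).
case: JN => m Nm; apply: (@quos_sub_prodIM _ _ J _ _ zs) => //.
  by case/regsP: rz.
by apply: nz => //; apply: zL.
Qed.

Lemma depth_eventually_constant :
  exists n0 d, forall n, (n0 <= n)%N -> depth_is J (N n) (K n) d.
Proof.
have gJN : good I (fun n => addS (K n) (prodIM J (N n))).
  by apply: good_add => //; apply: good_prodIM.
(* Either $JM_n=M_n$ for all large $n$, where $M_n=N_n/K_n$, and the depth is infinite, or this
   holds for no large $n$. *)
have [n0 [JN|JN]] := good_subS gN gJN; first by exists n0, None.
have JN' : eventually (fun n => ~ subS (N n) (addS (K n) (prodIM J (N n)))) by exists n0.
have [zs [n1 H]] := common_maximal_regs JN'.
exists (maxn n0 n1), (Some (size zs)) => n; rewrite geq_max => /andP[le0 le1].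
have {}JN := JN n le0.
by apply: depth_is_size => //; apply/maximal_regular_seqP => //; apply: H.
Qed.

End Asymptotics.

Theorem theorem2p7 (R : comPzRingType) (T : lmodType R)
    (I J : R -> Prop) (U V W : T -> Prop) :
  noetherian_ring R -> is_ideal I -> is_ideal J ->
  finitely_generated_module T ->
  is_submodule U -> is_submodule V -> is_submodule W ->
  (forall x, W x -> V x) ->
  exists (n0 : nat) (d : option nat), forall n : nat, (n0 <= n)%N ->
    depth_is J (addS U (powIM I n V)) (powIM I n W) d.
Proof.
move=> noeR iI iJ fgT sU sV sW WV.
have sp n X : is_submodule X -> is_submodule (powIM I n X) by exact: submod_powIM.
apply: (depth_eventually_constant noeR fgT iI iJ).
- by move=> n; apply: submod_add => //; apply: sp.
- by move=> n; apply: sp.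
- by move=> n x /(powIM_mono WV); apply: addSr.
- exact: good_add_powIM.
(* $I^nW=0+I^nW$ is good with [E] zero and offset 0. *)
exists 0%N, (fun x => x = 0), W; split=> //; first exact: submod_zero.
by move=> n; rewrite addn0 add0S.
Qed.
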